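(* Let $s\ge2$ and let $\eta^{(0)}=(\eta^{(0)}_1,\dots,\eta^{(0)}_n)$, $\eta^{(1)}=(\eta^{(1)}_1,\dots,\eta^{(1)}_n)\in H^s(\mathbb{R})^n$. For $t\ge0$ define $\eta(t),\pi(t)\in L^2(\mathbb{R})^n$ through their Fourier transforms by \[ \begin{pmatrix}\hat\eta(k,t)\\ \hat\pi(k,t)\end{pmatrix}=\exp\big(t\mathcal{M}(k)\big)\begin{pmatrix}\hat\eta^{(0)}(k)\\ \hat\eta^{(1)}(k)\end{pmatrix}\quad(k\in\mathbb{R}\setminus\{0\}). \] Then for every $T>0$ there is a constant $C=C(T,n,h,U)$ such that for all $t\in[0,T]$ \[ \sum_{i=1}^n\big(\|\eta_i(t)\|_{L^2}^2+\|\pi_i(t)\|_{L^2}^2\big)\le C^2\sum_{i=1}^n\big(\|\eta^{(0)}_i\|_{H^s}^2+\|\eta^{(1)}_i\|_{H^s}^2\big). \]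
   Context: Fix $n\ge1$, real numbers $h_0<h_1<\dots<h_{n+1}$, $\Delta h_i=h_{i+1}-h_i$ ($0\le i\le n$), and real $U_0,\dots,U_n$. For real $k\neq0$ define the symmetric tridiagonal $n\times n$ real matrices (indices $1\le i\le n$, and $1\le i\le n-1$ for off-diagonals): $\mathcal{A}_{ii}=1+\frac{\coth(k\Delta h_{i-1})+\coth(k\Delta h_i)}{k}$, $\mathcal{A}_{i,i+1}=\mathcal{A}_{i+1,i}=-\frac{\operatorname{csch}(k\Delta h_i)}{k}$; $\mathcal{B}_{ii}=U_{i-1}^2\coth(k\Delta h_{i-1})+U_i^2\coth(k\Delta h_i)$, $\mathcal{B}_{i,i+1}=\mathcal{B}_{i+1,i}=-U_i^2\operatorname{csch}(k\Delta h_i)$; $\mathcal{C}_{ii}=U_{i-1}\coth(k\Delta h_{i-1})+U_i\coth(k\Delta h_i)$, $\mathcal{C}_{i,i+1}=\mathcal{C}_{i+1,i}=-U_i\operatorname{csch}(k\Delta h_i)$; all other entries zero. Define $\mathcal{M}_1(k)=\begin{pmatrix}I_n&0\\0&\mathcal{A}(k)\end{pmatrix}$, $\mathcal{M}_2(k)=\begin{pmatrix}0&I_n\\k\mathcal{B}(k)-k^4I_n&-2i\,\mathcal{C}(k)\end{pmatrix}$ and $\mathcal{M}(k)=\mathcal{M}_1(k)^{-1}\mathcal{M}_2(k)$ ($\mathcal{A}(k)$ is invertible for real $k\ne0$). The Fourier transform is $\hat f(k)=\int e^{-ikx}f(x)\,dx$, applied componentwise; $H^s(\mathbb{R})$ is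 the $L^2$-Sobolev space. This describes the Fourier-space solution of the linearised problem for $n$ plates (amplitudes $\eta_i$, velocities $\pi_i=\partial_t\eta_i$) in a flat channel. *)

(* Defs.v *)
From HB Require Import structures.
From mathcomp Require Import all_boot all_order all_algebra.
From mathcomp Require Import all_classical all_reals all_analysis.
From mathcomp Require Import complex.
Set Implicit Arguments. Unset Strict Implicit. Unset Printing Implicit Defensive.
Import Order.TTheory GRing.Theory Num.Theory.
Import numFieldNormedType.Exports.
Local Open Scope ring_scope.
Local Open Scope complex_scope.
Local Open Scope classical_set_scope.

Section Defs.
Variable R : realType.
Local Notation C := R[i].
Local Notation mu := (@lebesgue_measure R).

Definition sinhR (x : R) : R := (expR x - expR (- x)) / 2.
Definition coshR (x : R) : R := (expR x + expR (- x)) / 2.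
Definition cothR (x : R) : R := coshR x / sinhR x.
Definition cschR (x : R) : R := (sinhR x)^-1.

Definition cabs2 (z : C) : R := complex.Re z ^+ 2 + complex.Im z ^+ 2.

Definition mxpow m (A : 'M[C]_m) (l : nat) : 'M[C]_m := iter l (mulmx A) 1%:M.
Definition mxexp_partial m (A : 'M[C]_m) (N : nat) : 'M[C]_m :=
  \sum_(l < N) ((l`!)%:R)^-1 *: mxpow A l.
Definition mxexp m (A : 'M[C]_m) : 'M[C]_m :=
  \matrix_(i, j)
    Complex (limn (fun N => complex.Re (mxexp_partial A N i j)))
            (limn (fun N => complex.Im (mxexp_partial A N i j))).

(* Data of the problem: h : nat -> R (h_0..h_{n+1}), U : nat -> R (U_0..U_n).
   Paper indices 1..n are shifted to 0..n-1 ('I_n). *)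
Definition dh (h : nat -> R) (j : nat) : R := h j.+1 - h j.

Definition tridiag n (d o : nat -> R) : 'M[R]_n :=
  \matrix_(i, j) (if i == j then d i
                  else if (i.+1 == j :> nat) || (j.+1 == i :> nat)
                       then o (minn i j) else 0).

Definition matA n (h : nat -> R) (k : R) : 'M[R]_n :=
  tridiag n (fun i => 1 + (cothR (k * dh h i) + cothR (k * dh h i.+1)) / k)
            (fun i => - cschR (k * dh h i.+1) / k).
Definition matB n (h U : nat -> R) (k : R) : 'M[R]_n :=
  tridiag n (fun i => U i ^+ 2 * cothR (k * dh h i) + U i.+1 ^+ 2 * cothR (k * dh h i.+1))
            (fun i => - (U i.+1 ^+ 2 * cschR (k * dh h i.+1))).
Definition matC n (h U : nat -> R) (k : R) : 'M[R]_n :=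
  tridiag n (fun i => U i * cothR (k * dh h i) + U i.+1 * cothR (k * dh h i.+1))
            (fun i => - (U i.+1 * cschR (k * dh h i.+1))).

Definition toC m p (A : 'M[R]_(m, p)) : 'M[C]_(m, p) := map_mx (fun x => x%:C) A.

Definition matM1 n (h : nat -> R) (k : R) : 'M[C]_(n + n) :=
  block_mx 1%:M 0 0 (toC (matA n h k)).
Definition matM2 n (h U : nat -> R) (k : R) : 'M[C]_(n + n) :=
  block_mx 0 1%:M
           (toC (k *: matB n h U k - (k ^+ 4)%:M))
           (- ((2%:R)%:C * 'i) *: toC (matC n h U k)).
Definition matM n (h U : nat -> R) (k : R) : 'M[C]_(n + n) :=
  invmx (matM1 n h k) *m matM2 n h U k.

Definition cmeasurable (f : R -> C) : Prop :=
  measurable_fun setT (fun x => complex.Re (f x)) /\ measurable_fun setT (fun x => complex.Im (f x)).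

Definition L2norm2 (f : R -> C) : \bar R := (\int[mu]_x (cabs2 (f x))%:E)%E.

Definition isL2 (f : R -> C) : Prop := cmeasurable f /\ (L2norm2 f < +oo)%E.

(* truncated Fourier integral  \int_{-N}^{N} e^{-ikx} g(x) dx *)
Definition trunc_fourier (g : R -> C) (N : nat) (k : R) : C :=
  Complex
    (Rintegral mu `[- N%:R, N%:R] (fun x => cos (k * x) * complex.Re (g x) + sin (k * x) * complex.Im (g x)))
    (Rintegral mu `[- N%:R, N%:R] (fun x => cos (k * x) * complex.Im (g x) - sin (k * x) * complex.Re (g x))).

(* ghat is (a representative of) the L^2 (Plancherel) Fourier transform of the
   L^2 function g:  ghat = L^2-lim_{N -> oo} \int_{-N}^{N} e^{-ikx} g(x) dx *)
Definition is_fourier (g ghat : R -> C) : Prop :=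
  isL2 g /\ isL2 ghat /\
  (fun N : nat => L2norm2 (fun k => trunc_fourier g N k - ghat k)) @ \oo --> (0 : \bar R).

Definition Hs_norm2 (s : R) (ghat : R -> C) : \bar R :=
  (((2 * pi)^-1)%:E * \int[mu]_k ((powR (1 + k ^+ 2) s) * cabs2 (ghat k))%:E)%E.

Definition inHs (s : R) (g ghat : R -> C) : Prop :=
  is_fourier g ghat /\ (Hs_norm2 s ghat < +oo)%E.

End Defs.

(* Main.v *)
(* On the Fourier side eta' = p and A p' = (k B - k^4) eta - 2i C p with A, B, C
   real and symmetric.  k^2 A, k B and k C are k^2 I (resp. 0) plus combinations
   of the same positive layer forms, so that the C-term is skew and drops out of the
   rate of the energy k^2 <A p, p> + (1 + k^2 + k^6) |eta|^2, and the B-term is bounded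
   by the energy uniformly in k.  Gronwall's lemma and a discrete Poincare
   inequality (for |k| <= 1) give |(eta, p)(t)|^2 <= K (1 + k^2)^2 |(eta, p)(0)|^2.

   The transfer to x-space needs ||g||^2 <= c ||ghat||^2 for some constant c.  As
   (1 - cos(a k))/k^2 has integral c0 |a| by scaling, the square sin^2(e k/2)/k^2 has as
   cosine transform a multiple of the tent function, which is also the
   autocorrelation of the indicator of [0, e].  Hence the e-averages of g have L^2
   norm at most that of ghat, up to a constant. *)

(* The norm of M(k) is unbounded in k, so the exponential of a norm bound gives nothing uniform: the
   estimate has to come from an energy adapted to k. The factors k^2 (for A) and k (for B and C) are
   dictated by k -> 0, where coth(k d) and csch(k d) blow up like 1/(k d) while k coth(k d) and k
   csch(k d) stay bounded. For large |k| the difficulty is the restoring force k^4. Up to constants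
   the energy lies between (1 + k^2) |(eta, p)|^2 and (1 + k^2)^3 |(eta, p)|^2; the quotient is the
   loss (1 + k^2)^2, which (1 + k^2)^s absorbs as soon as s >= 2.

   The Sobolev norms of the data already live on the Fourier side, so only the solution has to be
   transferred, in one direction and with any constant: the mass c0 (which equals pi) enters through
   its positivity alone. The comparison is made for real functions with the real kernel cos + sin,
   after truncation to [-N, N], which matches the definition of the Fourier transform as a limit of
   truncated integrals. *)
Require Import Defs.
From HB Require Import structures.
From mathcomp Require Import all_boot all_order all_algebra.
From mathcomp Require Import all_classical all_reals all_analysis.
From mathcomp Require Import complex.
From mathcomp Require Import measurable_realfun.
From mathcomp Require Import ring lra.
Import Order.TTheory GRing.Theory Num.Theory.
Import numFieldNormedType.Exports.
Set Implicit Arguments.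
Unset Strict Implicit.
Unset Printing Implicit Defensive.
Local Open Scope ring_scope.
Local Open Scope classical_set_scope.

(** * Plancherel inequality *)

Section Fubini_dominated.
Variable R : realType.
Local Notation mu := (@lebesgue_measure R).

Lemma measurable_fun_EFin d (T : measurableType d) (D : set T) (g : T -> R) :
  measurable_fun D g -> measurable_fun D (fun x => (g x)%:E).
Proof. by move=> mg; exact/measurable_EFinP. Qed.

(** By Tonelli, the double integral of |h| is at most the product of the L^1 norms of [a] and
    [b]. *)
Lemma integrable_prod_dom (a b : R -> R) (h : R * R -> R) :
  measurable_fun setT h ->
  mu.-integrable setT (EFin \o a) -> mu.-integrable setT (EFin \o b) ->
  (forall z x, `|h (z, x)| <= a z * b x) ->
  (mu \x mu)%E.-integrable setT (EFin \o h).
Proof.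
move=> mh ia ib hab.
apply/integrable12ltyP; first exact/measurable_EFinP.
have mb : measurable_fun setT b by apply/measurable_EFinP; exact: measurable_int ib.
have ma : measurable_fun setT a by apply/measurable_EFinP; exact: measurable_int ia.
have mhz z : measurable_fun setT (fun x => h (z, x)).
  exact: measurableT_comp mh (pair1_measurable z).
apply: (@le_lt_trans _ _ (\int[mu]_z (`|(a z)%:E| * \int[mu]_x `|(b x)%:E|))%E).
  apply: ge0_le_integral => //=.
  - by move=> z _; exact: integral_ge0.
  - apply: (@measurable_fun_fubini_tonelli_F _ _ _ _ _ mu (abse \o (EFin \o h))) => //.
    + by apply: measurableT_comp => //; exact/measurable_EFinP.
    + move=> x; change (0%:E <= (`|h x|)%:E)%E; by rewrite lee_fin.
  - rewrite [X in measurable_fun _ X](_ : _ = (fun z => (\int[mu]_x `|(b x)%:E|) * (`|a z|)%:E)%E); last by apply/funext => z; rewrite muleC.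
    by apply: measurable_funeM; apply: measurable_fun_EFin; exact: measurableT_comp.
  - move=> z _; rewrite -ge0_integralZl//=; first last.
    + by apply: measurable_fun_EFin; apply: measurableT_comp.
    apply: ge0_le_integral => //=.
    + by apply: measurable_fun_EFin; exact: measurableT_comp (@normr_measurable R setT) (mhz z).
    + under eq_fun do rewrite -EFinM.
      by apply: measurable_fun_EFin; apply: measurable_funM => //; exact: measurableT_comp (@normr_measurable R setT) mb.
    + by move=> x _; rewrite -EFinM lee_fin (le_trans (hab z x))// -normrM ler_norm.
rewrite ge0_integralZr//=; last 2 first.
- by apply: measurable_fun_EFin; exact: measurableT_comp.
- exact: integral_ge0.
by apply: lte_mul_pinfty; [exact: integral_ge0 | rewrite ge0_fin_numE; [exact: (integrableP _ _ _ ia).2|exact: integral_ge0] | exact: (integrableP _ _ _ ib).2].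
Qed.

(** The product bound makes every section of [h] integrable, not only almost every one, so that the
    real-valued inner integrals agree everywhere with the extended ones. *)
Lemma Rfubini_dom (a b : R -> R) (h : R * R -> R) :
  measurable_fun setT h ->
  mu.-integrable setT (EFin \o a) -> mu.-integrable setT (EFin \o b) ->
  (forall z x, `|h (z, x)| <= a z * b x) ->
  \int[mu]_z \int[mu]_x h (z, x) = \int[mu]_x \int[mu]_z h (z, x).
Proof.
move=> mh ia ib hab.
have ih := integrable_prod_dom mh ia ib hab.
have ma : measurable_fun setT a by apply/measurable_EFinP; exact: measurable_int ia.
have mb : measurable_fun setT b by apply/measurable_EFinP; exact: measurable_int ib.
have i1 z : mu.-integrable setT (fun x => (h (z, x))%:E).
  apply: (@le_integrable _ _ _ mu _ measurableT _ (fun x => ((a z)%:E * (b x)%:E)%E)).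
  - by apply: measurable_fun_EFin; exact: measurableT_comp mh (pair1_measurable z).
  - by move=> x _; rewrite /= lee_fin (le_trans (hab z x))// ler_norm.
  - exact: integrableZl.
have i2 x : mu.-integrable setT (fun z => (h (z, x))%:E).
  apply: (@le_integrable _ _ _ mu _ measurableT _ (fun z => ((b x)%:E * (a z)%:E)%E)).
  - by apply: measurable_fun_EFin; exact: measurableT_comp mh (pair2_measurable x).
  - by move=> z _; rewrite /= lee_fin (le_trans (hab z x))// mulrC ler_norm.
  - exact: integrableZl.
rewrite /Rintegral; congr fine.
under eq_integral do rewrite fineK ?integrable_fin_num//.
under [RHS]eq_integral do rewrite fineK ?integrable_fin_num//.
exact: (Fubini ih).
Qed.
End Fubini_dominated.

(** * Scaling and reflection of Lebesgue integrals *)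

Section Linear_substitution.
Variable R : realType.
Local Notation mu := (@lebesgue_measure R).

(** The pushforward of [mu] under multiplication by a is a^-1 times [mu]; by uniqueness of Lebesgue
    measure this is checked on half-open intervals. *)
Lemma ge0_integral_scale (a : R) (f : R -> R) : 0 < a ->
  measurable_fun setT f -> (forall x, 0 <= f x) ->
  (\int[mu]_x (f (a * x))%:E = (a^-1)%:E * \int[mu]_x (f x)%:E)%E.
Proof.
move=> a0 mf f0.
have mM : measurable_fun [set: measurableTypeR R] ( *%R a : _ -> measurableTypeR R) by exact: mulrl_measurable.
have aV0 : 0 <= a^-1 by rewrite invr_ge0 ltW.
pose nu := mscale (NngNum aV0) mu.
have nuE A : measurable A -> pushforward mu ( *%R a : _ -> measurableTypeR R) A = nu A.
  move=> mA.
  pose nu' := mscale (NngNum (ltW a0)) (pushforward mu ( *%R a : _ -> measurableTypeR R)).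
  have E : mu A = nu' mM A.
    apply: (lebesgue_measure_unique (mu := nu' mM)) => //= _ [[x y]] _ <-.
    rewrite /nu' /mscale /= /pushforward.
    rewrite (_ : _ @^-1` _ = `]a^-1 * x, a^-1 * y]%classic); last first.
      apply/seteqP; split => z /=; rewrite !in_itv /= ltr_pdivrMl// ler_pdivlMl//.
    rewrite !lebesgue_measure_itv/= !lte_fin ltr_pM2l ?invr_gt0//.
    case: ifPn => _; last by rewrite mule0.
    by rewrite -!EFinB -EFinM -mulrBr mulVKf// gt_eqF.
  rewrite /nu /mscale /= E /nu' /mscale /= /pushforward muleA -EFinM mulVf ?mul1e// gt_eqF//.
transitivity (\int[nu]_x (f x)%:E)%E; last first.
  by rewrite /nu ge0_integral_mscale//= => [|x _]; [exact/measurable_EFinP|rewrite lee_fin].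
rewrite -[LHS]/(\int[mu]_(x in ( *%R a : _ -> measurableTypeR R) @^-1` setT) ((EFin \o f) \o *%R a) x)%E.
rewrite -ge0_integral_pushforward//=; [|exact/measurable_EFinP|by move=> y _; rewrite lee_fin].
by apply: eq_measure_integral => //= A mA _; exact: nuE.
Qed.

Lemma ge0_integral_opp (f : R -> R) :
  measurable_fun setT f -> (forall x, 0 <= f x) ->
  (\int[mu]_x (f (- x))%:E = \int[mu]_x (f x)%:E)%E.
Proof.
move=> mf f0.
rewrite -[LHS]/(\int[mu]_(x in (-%R : _ -> measurableTypeR R) @^-1` setT) ((EFin \o f) \o -%R) x)%E.
rewrite -ge0_integral_pushforward//=; [|exact/measurable_EFinP|by move=> y _; rewrite lee_fin].
by apply: eq_measure_integral => //= A mA _; exact: lebesgue_measureN.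
Qed.

Lemma Rintegral_odd (f : R -> R) :
  mu.-integrable setT (EFin \o f) -> (forall x, f (- x) = - f x) ->
  \int[mu]_x f x = 0.
Proof.
move=> iF fN.
have mf : measurable_fun setT f by apply/measurable_EFinP; exact: measurable_int iF.
have E : (\int[mu]_x (f (- x))%:E = \int[mu]_x (f x)%:E)%E.
  have := @integral_pushforward _ _ (measurableTypeR R) (measurableTypeR R) R -%R (@oppr_measurable R setT) mu setT (EFin \o f).
  move=> <- //.
  - by apply: eq_measure_integral => //= A mA _; exact: lebesgue_measureN.
  - exact: measurable_fun_EFin.
  - have := integrableN iF.
    by apply: eq_integrable => // x _ /=; rewrite fN.
have : \int[mu]_x f x = - \int[mu]_x f x.
  rewrite {1}/Rintegral -E; under eq_integral do rewrite fN -mulN1r EFinM.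
  rewrite integralZl// fineM ?mulN1r//; exact: integrable_fin_num.
lra.
Qed.
End Linear_substitution.

(** * Integral operators and their Gram kernels *)

Section Kernel_operators.
Variable R : realType.
Local Notation mu := (@lebesgue_measure R).

(** Tonelli applies to the positive and the negative part separately; their difference is
    measurable, and so is its image under [fine]. *)
Lemma measurable_fun_Rintegral (h : R * R -> R) :
  measurable_fun setT h -> measurable_fun setT (fun z => \int[mu]_x h (z, x)).
Proof.
move=> mh; apply: measurableT_comp; first exact: fine_measurable.
have mE : measurable_fun setT (fun zx => (h zx)%:E) by exact: measurable_fun_EFin.
pose p z := (\int[mu]_x (fun zx : R * R => (h zx)%:E)^\+ (z, x))%E.
pose q z := (\int[mu]_x (fun zx : R * R => (h zx)%:E)^\- (z, x))%E.
have pE z : (\int[mu]_x (fun x => (h (z, x))%:E)^\+ x)%E = p z.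
  by apply: eq_integral => x _; rewrite -[fun x => _]/((fun zx => (h zx)%:E) \o pair z) funepos_comp.
have qE z : (\int[mu]_x (fun x => (h (z, x))%:E)^\- x)%E = q z.
  by apply: eq_integral => x _; rewrite -[fun x => _]/((fun zx => (h zx)%:E) \o pair z) funeneg_comp.
have -> : (fun z => \int[mu]_x (h (z, x))%:E)%E = (fun z => p z - q z)%E.
  by apply/funext => z; rewrite integralE pE qE.
apply: emeasurable_funB.
- apply: (@measurable_fun_fubini_tonelli_F _ _ _ _ _ mu ((fun zx : R * R => (h zx)%:E)^\+)%E) => //.
  exact: measurable_funepos.
- apply: (@measurable_fun_fubini_tonelli_F _ _ _ _ _ mu ((fun zx : R * R => (h zx)%:E)^\-)%E) => //.
  exact: measurable_funeneg.
Qed.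

(* Two kernels G with the same "Gram kernel" on the right give operators with
   the same L^2 norms: this is how frequency and space sides are compared. *)
Lemma integral_sqr_kernel_op (f g : R -> R) (G : R * R -> R) :
  mu.-integrable setT (EFin \o f) ->
  measurable_fun setT G ->
  mu.-integrable setT (fun z => (g z ^+ 2)%:E) ->
  (forall z, 0 <= g z) ->
  (forall z x, `|f x * G (z, x)| <= g z * `|f x|) ->
  (\int[mu]_z ((\int[mu]_x (f x * G (z, x))) ^+ 2)%:E =
   (\int[mu]_y \int[mu]_x (f y * f x * \int[mu]_z (G (z, y) * G (z, x))))%:E)%E.
Proof.
move=> iF mG ig g0 Gg.
have mf : measurable_fun setT f by apply/measurable_EFinP; exact: measurable_int iF.
have iaf : mu.-integrable setT (EFin \o (fun x => `|f x|)).
  exact: integrable_abse iF.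
set L := \int[mu]_x `|f x|.
have L0 : 0 <= L by apply: Rintegral_ge0.
pose A z := \int[mu]_x (f x * G (z, x)).
have ifG z : mu.-integrable setT (EFin \o (fun x => f x * G (z, x))).
  apply: (@le_integrable _ _ _ mu _ measurableT _ (fun x => ((g z)%:E * (`|f x|)%:E)%E)).
  - apply/measurable_EFinP; apply: measurable_funM => //.
    exact: measurableT_comp mG (pair1_measurable z).
  - by move=> x _; rewrite /= lee_fin [leRHS]ger0_norm ?Gg ?mulr_ge0.
  - exact: integrableZl.
have AL z : `|A z| <= g z * L.
  apply: (le_trans (le_normr_Rintegral _ (ifG z))) => //.
  rewrite /L -RintegralZl//; apply: le_Rintegral => //.
  - exact: integrable_norm (ifG z).
  - exact: (integrableZl measurableT (g z) iaf).
have mfG : measurable_fun setT (fun zx : R * R => f zx.2 * G zx).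
  by apply: measurable_funM => //; exact: measurableT_comp mf measurable_snd.
have mA : measurable_fun setT A by exact: (measurable_fun_Rintegral mfG).
have iA2 : mu.-integrable setT (EFin \o (fun z => A z ^+ 2)).
  apply: (@le_integrable _ _ _ mu _ measurableT _ (fun z => ((L ^+ 2)%:E * (g z ^+ 2)%:E)%E)).
  - by apply/measurable_EFinP; exact: measurable_funX.
  - move=> z _; rewrite /= lee_fin [leRHS]ger0_norm; last by rewrite mulr_ge0 ?sqr_ge0.
    by rewrite normrX -exprMn mulrC ler_pXn2r// ?nnegrE ?mulr_ge0.
  - exact: integrableZl.
transitivity ((\int[mu]_z (A z ^+ 2))%:E)%E.
  by rewrite /Rintegral fineK// integrable_fin_num.
congr EFin.
(* One factor of the square is expanded as an integral over y, the other later as an integral over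
   x; each time the integral over z is moved inside. *)
transitivity (\int[mu]_z \int[mu]_y (f y * G (z, y) * A z)).
  apply: eq_Rintegral => z _; rewrite RintegralZr//.
have mh1 : measurable_fun setT (fun zy : R * R => f zy.2 * G zy * A zy.1).
  by apply: measurable_funM => //; exact: measurableT_comp mA measurable_fst.
have hab1 z y : `|f y * G (z, y) * A z| <= L * g z ^+ 2 * `|f y|.
  rewrite normrM; apply: (le_trans (ler_pM _ _ (Gg z y) (AL z))) => //.
  by rewrite le_eqVlt; apply/orP; left; apply/eqP; ring.
rewrite [LHS](Rfubini_dom mh1 (integrableZl measurableT L ig) iaf hab1) {mh1 hab1}.
apply: eq_Rintegral => y _ /=.
transitivity (\int[mu]_z \int[mu]_x (f x * G (z, x) * (f y * G (z, y)))).
  by apply: eq_Rintegral => z _; rewrite RintegralZr// mulrC.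
have mh1 : measurable_fun setT (fun zx : R * R => f zx.2 * G zx * (f y * G (zx.1, y))).
  apply: measurable_funM => //; apply: measurable_funM => //.
  by apply: measurableT_comp (measurableT_comp mG (pair2_measurable y)) measurable_fst.
have hab1 z x : `|f x * G (z, x) * (f y * G (z, y))| <= `|f y| * g z ^+ 2 * `|f x|.
  rewrite normrM; apply: (le_trans (ler_pM _ _ (Gg z x) (Gg z y))) => //.
  by rewrite le_eqVlt; apply/orP; left; apply/eqP; ring.
rewrite [LHS](Rfubini_dom mh1 (integrableZl measurableT `|f y| ig) iaf hab1) {mh1 hab1}.
apply: eq_Rintegral => x _ /=.
(* The hypothesis [Gg] bounds [G (z, w)] by [g z] only where [f w] is nonzero; if f vanishes at x or
   y, both sides are 0. *)
have [fyx0|fyx0] := eqVneq (f y * f x) 0.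
  rewrite fyx0 mul0r /Rintegral integral0_eq// => z _.
  have -> : f x * G (z, x) * (f y * G (z, y)) = f y * f x * (G (z, y) * G (z, x)) :> R by ring.
  by rewrite fyx0 mul0r.
have [fy0 fx0] : f y != 0 /\ f x != 0 by move: fyx0; rewrite mulf_eq0 negb_or => /andP.
have bG w z : f w != 0 -> `|G (z, w)| <= g z.
  move=> fw0; have := Gg z w.
  by rewrite normrM mulrC ler_pM2r ?normr_gt0.
rewrite -RintegralZl//.
  by apply: eq_Rintegral => z _; ring.
apply: (@le_integrable _ _ _ mu _ measurableT _ (fun z => (g z ^+ 2)%:E)) => //.
- apply: measurable_fun_EFin; apply: measurable_funM.
    exact: measurableT_comp mG (pair2_measurable y).
  exact: measurableT_comp mG (pair2_measurable x).
- move=> z _; rewrite /= lee_fin [leRHS]ger0_norm ?sqr_ge0// normrM expr2.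
  by apply: ler_pM => //; exact: bG.
Qed.
End Kernel_operators.

(** * The integral of (1 - cos(a k)) / k^2 *)

Section Fejer.
Variable R : realType.
Local Notation mu := (@lebesgue_measure R).

Lemma measurable_fun_sqr : measurable_fun setT (fun x : R => x ^+ 2).
Proof. exact: measurable_funX. Qed.

(** Writing x^-1 as x (x^2)^-1 reduces the claim to [powR] on nonnegative numbers; at 0 both sides
    are 0 by the convention on inverses. *)
Lemma measurable_fun_inv : measurable_fun setT (fun x : R => x^-1).
Proof.
rewrite (_ : (fun x : R => x^-1) = (fun x => x * (x ^+ 2) `^ (-1))); last first.
  apply/funext => x; rewrite powR_inv1 ?sqr_ge0//.
  have [->|x0] := eqVneq x 0; first by rewrite invr0 mul0r.
  by field.
apply: measurable_funM => //.
exact: (measurableT_comp (measurable_powR (-1 : R)) measurable_fun_sqr).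
Qed.

Lemma measurable_fun_sin : measurable_fun setT (@sin R).
Proof. by apply: continuous_measurable_fun; exact: continuous_sin. Qed.

Lemma measurable_fun_cos : measurable_fun setT (@cos R).
Proof. by apply: continuous_measurable_fun; exact: continuous_cos. Qed.

Lemma abs_sin_le (x : R) : `|sin x| <= `|x|.
Proof.
wlog x0 : x / 0 < x => [H|].
  have [->|xN0] := eqVneq x 0; first by rewrite sin0 normr0.
  have [/H//|x0] := ltP 0 x.
  have := H (- x); rewrite sinN !normrN; apply.
  by rewrite oppr_gt0 lt_neqAle xN0.
have ds y : y \in `]0, x[%R -> is_derive y 1 (@sin R) (cos y).
  by move=> _; exact: is_derive_sin.
have [c _] := MVT x0 ds (continuous_subspaceT (@continuous_sin R)).
rewrite sin0 !subr0 => ->; rewrite normrM ler_piMl//.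
exact: cos_max.
Qed.

Lemma one_sub_cos (x : R) : 1 - cos x = 2 * sin (x / 2) ^+ 2.
Proof.
have -> : cos x = cos ((x / 2) *+ 2) by congr cos; rewrite mulr2n; field.
by rewrite cos_mulr2n; have := cos2Dsin2 (x / 2); lra.
Qed.

Definition fejer (x : R) := (1 - cos x) / x ^+ 2.

Lemma fejer_ge0 x : 0 <= fejer x.
Proof. by rewrite /fejer divr_ge0 ?sqr_ge0// subr_ge0 cos_le1. Qed.

(** As 1 - cos x is at most x^2 / 2 and at most 2, the product (1 - cos x)(1 + x^2) is at most x^2 /
    2 + 2 x^2, whence 5/2. *)
Lemma fejer_le x : fejer x <= 5 / 2 * (oneDsqr x)^-1.
Proof.
have [->|x0] := eqVneq x 0.
  by rewrite /fejer expr0n /= invr0 mulr0 mulr_ge0// invr_ge0 (le_trans _ (oneDsqr_ge1 _)).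
have x2 : 0 < x ^+ 2 by rewrite exprn_even_gt0.
rewrite /fejer /oneDsqr ler_pdivrMr// mulrAC ler_pdivlMr; last by rewrite addr_gt0.
have h1 : 1 - cos x <= x ^+ 2 / 2.
  rewrite one_sub_cos.
  have : sin (x / 2) ^+ 2 <= (x / 2) ^+ 2.
    rewrite -[leLHS]real_normK ?num_real// -[leRHS]real_normK ?num_real//.
    by rewrite ler_pXn2r ?nnegrE//; exact: abs_sin_le.
  rewrite expr_div_n; lra.
have h2 : 1 - cos x <= 2 by have := cos_geN1 x; lra.
have : (1 - cos x) * x ^+ 2 <= 2 * x ^+ 2 by rewrite ler_wpM2r// ltW.
rewrite mulrDr mulr1; lra.
Qed.

Lemma measurable_fejer : measurable_fun setT fejer.
Proof.
apply: measurable_funM.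
  by apply: measurable_funB => //; exact: measurable_fun_cos.
exact: (measurableT_comp measurable_fun_inv measurable_fun_sqr).
Qed.

(** The integral over the half-line is known to be pi / 2; with [psi] the restriction to the
    half-line, the integrand is at most psi(x) + psi(-x). *)
Lemma integrable_oneDsqrV : mu.-integrable setT (fun x => ((oneDsqr x)^-1)%:E).
Proof.
have m1 : measurable_fun setT (fun x : R => (oneDsqr x)^-1).
  by apply: continuous_measurable_fun; exact: continuous_oneDsqrV.
have p0 (x : R) : 0 <= (oneDsqr x)^-1 by rewrite invr_ge0 (le_trans _ (oneDsqr_ge1 _)).
pose psi (x : R) : R := (oneDsqr x)^-1 * \1_(`[0%R, +oo[%classic) x.
have ind1 (x : R) : 0 <= x -> \1_(`[0%R, +oo[%classic) x = 1 :> R.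
  by move=> x0; rewrite indicE mem_set//= in_itv/= x0.
have psi0 x : 0 <= psi x by rewrite mulr_ge0.
have mpsi : measurable_fun setT psi by apply: measurable_funM => //; exact: measurable_indic.
apply/integrableP; split; first exact: measurable_fun_EFin.
apply: (@le_lt_trans _ _ (\int[mu]_x ((psi x)%:E + (psi (- x))%:E))%E).
  apply: ge0_le_integral => //=.
  - by apply: measurable_fun_EFin; exact: measurableT_comp (@normr_measurable R setT) m1.
  - apply: emeasurable_funD; apply: measurable_fun_EFin => //.
    exact: measurableT_comp mpsi (@oppr_measurable R setT).
  - move=> x _; rewrite ger0_norm// -EFinD lee_fin /psi.
    have [x0|x0] := leP 0 x.
      rewrite ind1// mulr1 lerDl; exact: (psi0 (- x)).
    rewrite addrC (ind1 (- x)) ?oppr_ge0 ?(ltW x0)// mulr1 /oneDsqr sqrrN lerDl.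
    exact: (psi0 x).
rewrite ge0_integralD//=; first last.
- by apply: measurable_fun_EFin => //; exact: measurableT_comp mpsi (@oppr_measurable R setT).
- by move=> x _; rewrite lee_fin.
- exact: measurable_fun_EFin.
- by move=> x _; rewrite lee_fin.
rewrite ge0_integral_opp//.
suff -> : (\int[mu]_x (psi x)%:E = (pi / 2)%:E)%E by rewrite -EFinD ltry.
rewrite -(integral0y_oneDsqr R) [RHS]integral_mkcond; apply: eq_integral => x _.
rewrite /psi patchE indicE; case: ifPn => _; rewrite ?mulr1 ?mulr0//.
Qed.

Lemma integrable_fejer : mu.-integrable setT (fun x => (fejer x)%:E).
Proof.
apply: (@le_integrable _ _ _ mu _ measurableT _ (fun x => ((5 / 2)%:E * ((oneDsqr x)^-1)%:E)%E)).
- by apply: measurable_fun_EFin; exact: measurable_fejer.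
- move=> x _; rewrite /= lee_fin ger0_norm ?fejer_ge0//.
  by rewrite (le_trans (fejer_le x))// ler_norm.
- by apply: integrableZl => //; exact: integrable_oneDsqrV.
Qed.

Definition fejer_mass := \int[mu]_x fejer x.

Lemma fejer_massE : (\int[mu]_x (fejer x)%:E = fejer_mass%:E)%E.
Proof. by rewrite /fejer_mass /Rintegral fineK// integrable_fin_num// integrable_fejer. Qed.

(** A zero mass would make [fejer] vanish almost everywhere, but it is positive on ]0, 1[, since cos
    x = 1 would force sin x = 0 there. *)
Lemma fejer_mass_gt0 : 0 < fejer_mass.
Proof.
rewrite lt_neqAle Rintegral_ge0 ?andbT; last by move=> x _; exact: fejer_ge0.
apply/negP => /eqP m0.
have mf : measurable_fun setT (fun x => (fejer x)%:E).
  by apply: measurable_fun_EFin; exact: measurable_fejer.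
have : (\int[mu]_x `|(fejer x)%:E| = 0)%E.
  under eq_integral do rewrite gee0_abs ?lee_fin ?fejer_ge0//.
  by rewrite fejer_massE -m0.
move/(ae_eq_integral_abs mu measurableT mf).1 => [N [mN N0 sN]].
have sub : `]0, 1[%classic `<=` N.
  move=> x /=; rewrite in_itv/= => /andP[x0 x1]; apply: sN => /= /(_ I) [].
  have s0 : 0 < sin x.
    by apply: sin_gt0_pi; rewrite x0 (lt_trans x1)// (lt_le_trans _ (pi_ge2 _))// ltr1n.
  move/eqP; rewrite /fejer mulf_eq0 invr_eq0 sqrf_eq0 (gt_eqF x0) orbF => /eqP c1.
  have := cos2Dsin2 x; have -> : cos x = 1 by lra.
  have : 0 < sin x ^+ 2 by rewrite exprn_gt0.
  lra.
have m01 : measurable (`]0, 1[%classic : set R) by exact: measurable_itv.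
have H : (mu `]0%R, 1%R[%classic <= mu N)%E by apply: le_measure; rewrite ?inE.
move: H; have -> : mu N = 0%E by exact: N0.
by rewrite lebesgue_measure_itv/= lte_fin ltr01 oppr0 adde0 lee_fin ler10.
Qed.

Definition fejer_at (a k : R) := (1 - cos (a * k)) / k ^+ 2.

Lemma fejer_atE a k : fejer_at a k = a ^+ 2 * fejer (`|a| * k).
Proof.
rewrite /fejer_at /fejer.
have -> : cos (`|a| * k) = cos (a * k).
  by case: (ger0P a) => // _; rewrite mulNr cosN.
have [->|k0] := eqVneq k 0; first by rewrite !mulr0 expr0n/= invr0 !mulr0.
have [->|a0] := eqVneq a 0; first by rewrite expr0n/= !mul0r cos0 subrr mul0r.
rewrite exprMn real_normK ?num_real//; field.
by rewrite a0 k0.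
Qed.

Lemma measurable_fejer_at a : measurable_fun setT (fejer_at a).
Proof.
apply: measurable_funM.
  apply: measurable_funB => //.
  exact: (measurableT_comp measurable_fun_cos (@mulrl_measurable R setT a)).
exact: (measurableT_comp measurable_fun_inv measurable_fun_sqr).
Qed.

Lemma fejer_at_ge0 a k : 0 <= fejer_at a k.
Proof. by rewrite /fejer_at divr_ge0 ?sqr_ge0// subr_ge0 cos_le1. Qed.

(** The substitution contributes |a|^-1 against the factor a^2 of [fejer_atE]. *)
Lemma integral_fejer_at a : (\int[mu]_k (fejer_at a k)%:E = (`|a| * fejer_mass)%:E)%E.
Proof.
have [->|a0] := eqVneq a 0.
  rewrite normr0 mul0r integral0_eq// => k _.
  by rewrite /fejer_at mul0r cos0 subrr mul0r.
under eq_integral do rewrite fejer_atE EFinM.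
rewrite ge0_integralZl//=; first last.
- by rewrite lee_fin sqr_ge0.
- by move=> x _; rewrite lee_fin fejer_ge0.
- apply: measurable_fun_EFin.
  exact: (measurableT_comp measurable_fejer (@mulrl_measurable R setT `|a|)).
rewrite ge0_integral_scale ?normr_gt0//; [|exact: measurable_fejer|exact: fejer_ge0].
rewrite fejer_massE -!EFinM mulrA; congr (_ * _)%:E.
by rewrite -real_normK ?num_real// expr2 mulfK// normr_eq0.
Qed.

Lemma integrable_fejer_at a : mu.-integrable setT (fun k => (fejer_at a k)%:E).
Proof.
apply/integrableP; split.
  by apply: measurable_fun_EFin; exact: measurable_fejer_at.
under eq_integral do rewrite gee0_abs ?lee_fin ?fejer_at_ge0//.
by rewrite integral_fejer_at ltry.
Qed.

Lemma Rintegral_fejer_at a : \int[mu]_k fejer_at a k = `|a| * fejer_mass.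
Proof. by rewrite /Rintegral integral_fejer_at. Qed.

End Fejer.

(** * Averages of f compared with its Hartley transform *)

Section Hartley.
Variable R : realType.
Local Notation mu := (@lebesgue_measure R).
Local Notation cF := (fejer_mass R).

(** For e > 0 this is max(0, e - |u|). The form with absolute values displays it as the combination
    of masses |a| that [cas_kernel_mul] produces. *)
Definition tent (e u : R) : R := 2^-1 * (`|e + u| + `|e - u|) - `|u|.

(* With cas = cos + sin, cas(zx) cas(zy) = cos(z(x - y)) + sin(z(x + y)), and the
   last term is odd in z: the integral over z then only sees x - y. *)
Definition cas_kernel (e : R) (zx : R * R) : R :=
  sin (e * zx.1 / 2) / zx.1 * (cos (zx.1 * zx.2) + sin (zx.1 * zx.2)).

(** Integrating f against it in the second variable gives e times the average of f over
    [z, z + e]. *)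
Definition box_kernel (e : R) (zx : R * R) : R :=
  \1_(`[0%R, e]%classic) (zx.2 - zx.1).

(** Here 2 sin^2(e z / 2) = 1 - cos(e z) and, with u = y - x, (1 - cos(e z)) cos(u z) is half the
    sum of 1 - cos((e + u) z) and 1 - cos((e - u) z), minus 1 - cos(u z). Each term divided by z^2
    is integrable with known integral. *)
Lemma cas_kernel_mul e x y z :
  cas_kernel e (z, y) * cas_kernel e (z, x) =
  2^-1 * (2^-1 * (fejer_at (e + (y - x)) z + fejer_at (e - (y - x)) z) -
          fejer_at (y - x) z) +
  2^-1 * (fejer_at e z * sin ((x + y) * z)).
Proof.
rewrite /cas_kernel /fejer_at /=.
have [->|z0] := eqVneq z 0.
  by rewrite !mulr0 !mul0r sin0 cos0 !subrr !mul0r !(addr0, mulr0, subr0).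
have s2 : 2 * (sin (e * z / 2) * sin (e * z / 2)) = 1 - cos (e * z).
  by rewrite one_sub_cos expr2.
set S := sin (e * z / 2) in s2 *.
have -> : (e + (y - x)) * z = e * z + (y - x) * z by ring.
have -> : (e - (y - x)) * z = e * z - (y - x) * z by ring.
rewrite cosD cosB.
have cu : cos ((y - x) * z) = cos (z * y) * cos (z * x) + sin (z * y) * sin (z * x).
  by rewrite -cosB; congr cos; ring.
have sv : sin ((x + y) * z) = sin (z * x) * cos (z * y) + cos (z * x) * sin (z * y).
  by rewrite -sinD; congr sin; ring.
transitivity ((2 * (S * S)) / (2 * z ^+ 2) * (cos ((y - x) * z) + sin ((x + y) * z))).
  by rewrite cu sv; field.
by rewrite s2; field.
Qed.

Lemma Rintegral_cas_kernel e x y :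
  mu.-integrable setT (EFin \o (fun z => cas_kernel e (z, y) * cas_kernel e (z, x))) /\
  \int[mu]_z (cas_kernel e (z, y) * cas_kernel e (z, x)) =
  cF / 2 * tent e (y - x).
Proof.
have /funext KE := cas_kernel_mul e x y; rewrite KE {KE}.
have iC a : mu.-integrable setT (EFin \o (@fejer_at R a)) := integrable_fejer_at a.
have iA : mu.-integrable setT (EFin \o (fun z => fejer_at (e + (y - x)) z + fejer_at (e - (y - x)) z)).
  exact: (integrableD measurableT (iC _) (iC _)).
have iA2 : mu.-integrable setT (EFin \o (fun z => 2^-1 * (fejer_at (e + (y - x)) z + fejer_at (e - (y - x)) z))).
  exact: (integrableZl measurableT (2^-1) iA).
have iB : mu.-integrable setT (EFin \o (fun z => 2^-1 * (fejer_at (e + (y - x)) z + fejer_at (e - (y - x)) z) -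
          fejer_at (y - x) z)).
  exact: (integrableB measurableT iA2 (iC _)).
have iB2 : mu.-integrable setT (EFin \o (fun z => 2^-1 * (2^-1 * (fejer_at (e + (y - x)) z + fejer_at (e - (y - x)) z) -
          fejer_at (y - x) z))).
  exact: (integrableZl measurableT (2^-1) iB).
have iO : mu.-integrable setT (EFin \o (fun z => fejer_at e z * sin ((x + y) * z))).
  apply: (@le_integrable _ _ _ mu _ measurableT _ (EFin \o (@fejer_at R e))) => //.
  - apply: measurable_fun_EFin; apply: measurable_funM; first exact: measurable_fejer_at.
    exact: (measurableT_comp (@measurable_fun_sin R) (@mulrl_measurable R setT _)).
  - move=> z _; rewrite /= lee_fin normrM ler_piMr//; exact: sin_max.
have iO2 : mu.-integrable setT (EFin \o (fun z => 2^-1 * (fejer_at e z * sin ((x + y) * z)))).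
  exact: (integrableZl measurableT (2^-1) iO).
split; first exact: (integrableD measurableT iB2 iO2).
rewrite (RintegralD measurableT iB2 iO2).
rewrite (RintegralZl _ measurableT iB) (RintegralZl _ measurableT iO).
rewrite (RintegralB measurableT iA2 (iC _)) (RintegralZl _ measurableT iA).
rewrite (RintegralD measurableT (iC _) (iC _)).
rewrite !Rintegral_fejer_at (Rintegral_odd iO); last first.
  by move=> z; rewrite /fejer_at mulrN cosN sqrrN mulrN sinN mulrN.
by rewrite /tent; field.
Qed.

Lemma box_kernel_mul (e x y z : R) :
  box_kernel e (z, y) * box_kernel e (z, x) =
  \1_(`[Num.max x y - e, Num.min x y]%classic) z.
Proof.
rewrite /box_kernel !indicE -natrM mulnb; congr (_ %:R); congr nat_of_bool.
rewrite !mem_setE !in_itv/= [Num.max x y - e <= z]lerBlDr ge_max le_min.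
by apply/idP/idP => /andP[/andP[h1 h2] /andP[h3 h4]]; do ![apply/andP; split]; lra.
Qed.

Lemma Rintegral_box_kernel e x y : 0 < e ->
  \int[mu]_z (box_kernel e (z, y) * box_kernel e (z, x)) = tent e (y - x).
Proof.
move=> e0.
transitivity (\int[mu]_z \1_(`[Num.max x y - e, Num.min x y]%classic) z).
  by apply: eq_Rintegral => z _; exact: box_kernel_mul.
transitivity (fine (mu `[Num.max x y - e, Num.min x y]%classic)).
  by rewrite /Rintegral integral_indic// setIT.
rewrite lebesgue_measure_itv/= lte_fin /tent.
by case: (leP x y) => xy; case: ifPn => h /=; move: h; rewrite -?leNgt => h;
  case: (ger0P (e + (y - x))) => h1; case: (ger0P (e - (y - x))) => h2; case: (ger0P (y - x)) => h3; lra.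
Qed.

Lemma measurable_cas_kernel e : measurable_fun setT (cas_kernel e).
Proof.
have m1 : measurable_fun setT (fun zx : R * R => zx.1) by exact: measurable_fst.
have m2 : measurable_fun setT (fun zx : R * R => zx.2) by exact: measurable_snd.
have m12 : measurable_fun setT (fun zx : R * R => zx.1 * zx.2) by exact: measurable_funM.
apply: measurable_funM; first apply: measurable_funM.
- have me : measurable_fun setT (fun zx : R * R => e * zx.1 / 2).
    by apply: measurable_funM => //; apply: measurable_funM.
  exact: (measurableT_comp (@measurable_fun_sin R) me).
- exact: (measurableT_comp (@measurable_fun_inv R) m1).
- apply: measurable_funD.
    exact: (measurableT_comp (@measurable_fun_cos R) m12).
  exact: (measurableT_comp (@measurable_fun_sin R) m12).
Qed.

Lemma measurable_box_kernel e : measurable_fun setT (box_kernel e).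
Proof.
have m12 : measurable_fun setT (fun zx : R * R => zx.2 - zx.1).
  by apply: measurable_funB; [exact: measurable_snd|exact: measurable_fst].
have mi : measurable_fun setT (\1_(`[0%R, e]%classic) : R -> R).
  by apply: measurable_indic; exact: measurable_itv.
exact: (measurableT_comp mi m12).
Qed.

(** The Hartley transform: for real f it carries the same L^2 information as the Fourier transform
    and stays real-valued. *)
Definition hartley (f : R -> R) (k : R) : R :=
  \int[mu]_x (f x * (cos (k * x) + sin (k * x))).

Lemma measurable_hartley (f : R -> R) :
  mu.-integrable setT (EFin \o f) -> measurable_fun setT (hartley f).
Proof.
move=> iF; have mf : measurable_fun setT f by apply/measurable_EFinP; exact: measurable_int iF.
apply: (@measurable_fun_Rintegral R (fun zx => f zx.2 * (cos (zx.1 * zx.2) + sin (zx.1 * zx.2)))).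
have m12 : measurable_fun setT (fun zx : R * R => zx.1 * zx.2).
  by apply: measurable_funM; [exact: measurable_fst|exact: measurable_snd].
apply: measurable_funM; first exact: (measurableT_comp mf measurable_snd).
apply: measurable_funD.
  exact: (measurableT_comp (@measurable_fun_cos R) m12).
exact: (measurableT_comp (@measurable_fun_sin R) m12).
Qed.

Lemma fejer_atE_sin (e z : R) : fejer_at e z = 2 * (sin (e * z / 2) / z) ^+ 2.
Proof. by rewrite /fejer_at one_sub_cos expr_div_n -[LHS]mulrA. Qed.

(** Both kernels have the tent as Gram kernel, up to the factor cF / 2, so the two operators have
    proportional L^2 norms on f. The [cas_kernel] operator is multiplication of [hartley f] by sin(e
    z / 2) / z, whose square is at most e^2 / 4. *)
Lemma integral_box_kernel_le (f : R -> R) (N e : R) :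
  mu.-integrable setT (EFin \o f) -> (forall x, f x != 0 -> `|x| <= N) ->
  0 < e -> e <= 1 ->
  (\int[mu]_z ((\int[mu]_x (f x * box_kernel e (z, x))) ^+ 2)%:E <=
    (e ^+ 2 / (2 * cF))%:E * \int[mu]_k (hartley f k ^+ 2)%:E)%E.
Proof.
move=> iF fN e0 e1.
have c0 := fejer_mass_gt0 R.
have mf : measurable_fun setT f by apply/measurable_EFinP; exact: measurable_int iF.
(* If f x and the box are nonzero, then z <= x <= z + e with |x| <= N and e <= 1, so z lies in
   [-N - 1, N]: this indicator dominates the kernel on the support of f. *)
rewrite (integral_sqr_kernel_op (g := \1_(`[- N - 1, N]%classic)))//; first last.
- move=> z x; have [->|fx0] := eqVneq (f x) 0; first by rewrite mul0r normr0 mulr0.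
  rewrite normrM mulrC ler_pM2r ?normr_gt0// /box_kernel /= !indicE !normr_nat ler_nat.
  have := fN x fx0; rewrite ler_norml => /andP[x1 x2].
  case: (boolP (x - z \in _)) => //; rewrite inE/= in_itv/= => /andP[h1 h2].
  by rewrite mem_set//= in_itv/=; apply/andP; split; lra.
- apply: (@eq_integrable _ _ _ mu _ measurableT (EFin \o \1_(`[- N - 1, N]%classic))).
    by move=> z _ /=; rewrite indicE; case: (_ \in _); rewrite ?expr1n ?expr0n.
  by apply: integrable_indic_itv.
- exact: measurable_box_kernel.
(* The normalisation r^2 (cF / 2) = 1 makes the two Gram kernels equal. *)
pose r := Num.sqrt (2 / cF).
have r0 : 0 <= r by exact: sqrtr_ge0.
have r2 : r ^+ 2 = 2 / cF by rewrite sqr_sqrtr// divr_ge0// ltW.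
have mG : measurable_fun setT (fun zx => r * cas_kernel e zx).
  by apply: measurable_funM => //; exact: measurable_cas_kernel.
have cas2 (t : R) : `|cos t + sin t| <= 2.
  by rewrite (le_trans (ler_normD _ _))// (_ : 2 = 1 + 1)// lerD ?cos_max ?sin_max.
have H := integral_sqr_kernel_op (f := f) (G := fun zx => r * cas_kernel e zx)
  (g := fun z => r * (2 * `|sin (e * z / 2) / z|)) iF mG.
have -> : \int[mu]_y \int[mu]_x (f y * f x * \int[mu]_z (box_kernel e (z, y) * box_kernel e (z, x))) =
   \int[mu]_y \int[mu]_x (f y * f x * \int[mu]_z ((r * cas_kernel e (z, y)) * (r * cas_kernel e (z, x)))).
  apply: eq_Rintegral => y _; apply: eq_Rintegral => x _; congr (_ * _).
  have [iK KE] := Rintegral_cas_kernel e x y.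
  rewrite Rintegral_box_kernel//.
  transitivity (\int[mu]_z (r ^+ 2 * (cas_kernel e (z, y) * cas_kernel e (z, x)))).
    by rewrite RintegralZl// KE r2; field; rewrite gt_eqF.
  by apply: eq_Rintegral => z _; ring.
rewrite -H; first last.
- move=> z x; rewrite normrM mulrC ler_wpM2r// normrM ger0_norm// ler_wpM2l//.
  by rewrite /cas_kernel /= normrM mulrC ler_wpM2r.
- by move=> z; rewrite !mulr_ge0.
- apply: (@eq_integrable _ _ _ mu _ measurableT (fun z => ((r ^+ 2 * 2)%:E * (fejer_at e z)%:E)%E)).
    move=> z _; rewrite fejer_atE_sin -EFinM; congr EFin.
    by rewrite -[(sin _ / _) ^+ 2]real_normK ?num_real//; ring.
  by apply: integrableZl => //; exact: integrable_fejer_at.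
have icas z : mu.-integrable setT (EFin \o (fun x => f x * (cos (z * x) + sin (z * x)))).
  apply: (@le_integrable _ _ _ mu _ measurableT _ (fun x => (2%:E * (f x)%:E)%E)).
  - apply: measurable_fun_EFin; apply: measurable_funM => //; apply: measurable_funD.
      exact: (measurableT_comp (@measurable_fun_cos R) (@mulrl_measurable R setT z)).
    exact: (measurableT_comp (@measurable_fun_sin R) (@mulrl_measurable R setT z)).
  - by move=> x _; rewrite /= lee_fin !normrM [`|2|]ger0_norm// mulrC ler_wpM2r.
  - exact: integrableZl.
have mH := measurable_hartley iF.
rewrite -ge0_integralZl//=; first last.
- by rewrite lee_fin divr_ge0 ?sqr_ge0// mulr_ge0// ltW.
- by move=> k _; rewrite lee_fin sqr_ge0.
- by apply: measurable_fun_EFin; exact: measurable_funX.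
have opE z : \int[mu]_x (f x * (r * cas_kernel e (z, x))) =
    r * (sin (e * z / 2) / z) * hartley f z.
  rewrite /hartley -RintegralZl//; apply: eq_Rintegral => x _.
  by rewrite /cas_kernel /=; ring.
apply: ge0_le_integral => //=.
- by move=> z _; rewrite lee_fin sqr_ge0.
- apply: measurable_fun_EFin; apply: measurable_funX.
  apply: (@measurable_fun_Rintegral R (fun zx => f zx.2 * (r * cas_kernel e zx))).
  by apply: measurable_funM => //; exact: (measurableT_comp mf measurable_snd).
- under eq_fun do rewrite -EFinM.
  by apply: measurable_fun_EFin; apply: measurable_funM => //; exact: measurable_funX.
- move=> z _; rewrite -EFinM lee_fin opE !exprMn r2.
  rewrite ler_wpM2r ?sqr_ge0//.
  have sz : (sin (e * z / 2) / z) ^+ 2 <= e ^+ 2 / 4.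
    have [->|z0] := eqVneq z 0; first by rewrite invr0 mulr0 expr0n/= divr_ge0 ?sqr_ge0.
    rewrite expr_div_n ler_pdivrMr ?exprn_even_gt0//.
    have := abs_sin_le (e * z / 2).
    rewrite -ler_sqr ?nnegrE// !real_normK ?num_real// => /le_trans; apply.
    by rewrite le_eqVlt; apply/orP; left; apply/eqP; field.
  rewrite -exprMn.
  apply: (le_trans (ler_wpM2l _ sz)); first by rewrite divr_ge0// ltW.
  by rewrite le_eqVlt; apply/orP; left; apply/eqP; field; rewrite gt_eqF.
Qed.

(* The averages of f over [z, z + 1/(n+1)] converge to f almost everywhere by
   Lebesgue differentiation; Fatou's lemma passes the bound to the limit. *)
Lemma sqr_integral_le_hartley (f : R -> R) (N : R) :
  mu.-integrable setT (EFin \o f) -> (forall x, f x != 0 -> `|x| <= N) ->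
  (\int[mu]_x (f x ^+ 2)%:E <= (2 * cF)^-1%:E * \int[mu]_k (hartley f k ^+ 2)%:E)%E.
Proof.
move=> iF fN.
have c0 := fejer_mass_gt0 R.
have mf : measurable_fun setT f by apply/measurable_EFinP; exact: measurable_int iF.
pose A n z := n.+1%:R * \int[mu]_x (f x * box_kernel n.+1%:R^-1 (z, x)).
have mA n : measurable_fun setT (fun z => ((A n z) ^+ 2)%:E).
  apply: measurable_fun_EFin; apply: measurable_funX; apply: measurable_funM => //.
  apply: (@measurable_fun_Rintegral R (fun zx => f zx.2 * box_kernel n.+1%:R^-1 zx)).
  apply: measurable_funM; first exact: (measurableT_comp mf measurable_snd).
  exact: measurable_box_kernel.
have locf : locally_integrable setT f by apply: open_integrable_locally => //; exact: openT.
pose E (x : R) n := `[x, x + n.+1%:R^-1]%classic.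
have muE x n : mu (E x n) = (n.+1%:R^-1)%:E.
  by rewrite /E lebesgue_measure_itv/= lte_fin ltrDl invr_gt0 ltr0n/= -EFinD addrAC subrr add0r.
have niceE x : nicely_shrinking x (E x).
  split=> [n|]; first exact: measurable_itv.
  have d0 n : 0 < 2 * n.+1%:R^-1 :> R by rewrite mulr_gt0// invr_gt0.
  (* Balls are open, so radius 2 / (n + 1) is taken to contain the closed interval
     [x, x + 1 / (n + 1)]; such a ball has 4 times its measure. *)
  exists (4, fun n => PosNum (d0 n)); split => //=.
  - rewrite -[X in _ --> X](mulr0 2); apply: cvgMl_tmp; exact: cvg_harmonic.
  - move=> n y; rewrite /E/= in_itv/= /ball/= => /andP[xy yx].
    rewrite ler0_norm ?subr_le0// opprB.
    by move: (d0 n) yx xy; set d := n.+1%:R^-1; lra.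
  - move=> n; rewrite (lebesgue_measure_ball _ (ltW (d0 n))) -/mu muE -EFinM lee_fin.
    by rewrite -[_ *+ 2]mulr_natl mulrA -natrM.
have AE n z : ((mu (E z n))^-1 * \int[mu]_(y in E z n) (f y)%:E = (A n z)%:E)%E.
  rewrite muE inver gt_eqF ?invr_gt0// invrK EFinM; congr (_ * _)%E.
  have boxE x : f x * box_kernel n.+1%:R^-1 (z, x) = (f \_ (E z n)) x.
    rewrite /box_kernel patchE indicE /= !mem_setE !in_itv/= subr_ge0 lerBlDl.
    by case: ifP; rewrite ?mulr1 ?mulr0.
  have iE : mu.-integrable (E z n) (EFin \o f).
    by apply: integrableS iF => //; exact: measurable_itv.
  have -> : \int[mu]_x (f x * box_kernel n.+1%:R^-1 (z, x)) = \int[mu]_(x in E z n) f x.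
    by rewrite [RHS]Rintegral_mkcond; apply: eq_Rintegral => x _; exact: boxE.
  by rewrite /Rintegral fineK//; apply: integrable_fin_num => //; exact: measurable_itv.
apply: (@le_trans _ _ (\int[mu]_x limn_einf (fun n => (A n x ^+ 2)%:E))%E).
  apply: ae_ge0_le_integral => //.
  - by move=> x _; rewrite lee_fin sqr_ge0.
  - by apply: measurable_fun_EFin; exact: measurable_funX.
  - move=> x _; rewrite limn_einf_lim; apply: lime_ge; first exact: is_cvg_einfs.
    by apply: nearW => n; apply: le_ereal_inf_tmp => _ [m _ <-]; rewrite lee_fin sqr_ge0.
  - have me := measurable_fun_einfs mA.
    apply: (emeasurable_fun_cvg (fun n x => einfs (fun m => (A m x ^+ 2)%:E) n)) => //.
    by move=> x _; rewrite limn_einf_lim; exact: is_cvg_einfs.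
  - have [N0 [mN0 N00 sub]] := lebesgue_differentiation locf.
    exists N0; split=> //; apply: subset_trans sub; apply: subsetC => x fx _.
    have := nice_lebesgue_differentiation niceE locf fx.
    under eq_fun do rewrite AE.
    move=> /fine_cvgP[_ Ax].
    have A2 : (A n x ^+ 2)%:E @[n --> \oo] --> (f x ^+ 2)%:E.
      apply: cvg_EFin; first exact: nearW.
      by apply: cvgM.
    by rewrite (cvg_limn_einf_sup A2).1.
apply: (le_trans (fatou mu measurableT mA _)).
  by move=> n x _; rewrite lee_fin sqr_ge0.
(* The factor (n + 1)^2 cancels the e^2 of [integral_box_kernel_le], so the bound is uniform in
   n. *)
have bd n : (\int[mu]_x (A n x ^+ 2)%:E <= (2 * cF)^-1%:E * \int[mu]_k (hartley f k ^+ 2)%:E)%E.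
  under eq_integral do rewrite exprMn EFinM.
  have e1 : n.+1%:R^-1 <= 1 :> R by rewrite invf_le1// ler1n.
  have e0 : 0 < n.+1%:R^-1 :> R by rewrite invr_gt0.
  rewrite ge0_integralZl//=; first last.
  - by move=> x _; rewrite lee_fin sqr_ge0.
  - apply: measurable_fun_EFin; apply: measurable_funX.
    apply: (@measurable_fun_Rintegral R (fun zx => f zx.2 * box_kernel n.+1%:R^-1 zx)).
    apply: measurable_funM; first exact: (measurableT_comp mf measurable_snd).
    exact: measurable_box_kernel.
  apply: (le_trans (lee_wpmul2l _ (integral_box_kernel_le iF fN e0 e1))).
    by rewrite lee_fin sqr_ge0.
  rewrite muleA -EFinM (_ : _ * _ = (2 * cF)^-1)%R//.
  by rewrite mulrA -exprMn divff// expr1n mul1r.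
rewrite limn_einf_lim; apply: lime_le; first exact: is_cvg_einfs.
apply: nearW => n; apply: le_trans (bd n).
by apply: ereal_inf_lbound; exists n => /=.
Qed.
End Hartley.

(** * From the Hartley bound to the Fourier transform *)

Section Plancherel.
Variable R : realType.
Local Open Scope complex_scope.
Local Notation mu := (@lebesgue_measure R).
Local Notation Re := (@complex.Re R).
Local Notation Im := (@complex.Im R).
Local Notation cF := (fejer_mass R).

Lemma cabs2_ge0 (z : R[i]) : 0 <= cabs2 z.
Proof. by rewrite /cabs2 addr_ge0 ?sqr_ge0. Qed.

(** The right side minus the left is |u - 2 v|^2. *)
Lemma cabs2_triangle (u v : R[i]) : cabs2 u <= 2 * cabs2 (u - v) + 2 * cabs2 v.
Proof.
case: u => a b; case: v => c d; rewrite /cabs2 /=.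
have := sqr_ge0 (a - 2 * c); have := sqr_ge0 (b - 2 * d).
rewrite !expr2; lra.
Qed.

Lemma measurable_cabs2 (f : R -> R[i]) :
  cmeasurable f -> measurable_fun setT (fun x => cabs2 (f x)).
Proof. by move=> [m1 m2]; apply: measurable_funD; exact: measurable_funX. Qed.

Section trunc.
Variables (g : R -> R[i]) (N : nat).
Hypothesis gL2 : isL2 g.
Let D := `[- N%:R, N%:R]%classic : set R.

Let mD : measurable D. Proof. exact: measurable_itv. Qed.

(** Extension by 0 gives functions on the whole line with bounded support, to which
    [sqr_integral_le_hartley] applies. *)
Definition trunc_re : R -> R := (fun x => Re (g x)) \_ D.
Definition trunc_im : R -> R := (fun x => Im (g x)) \_ D.

Let mre : measurable_fun setT (fun x => Re (g x)). Proof. exact: gL2.1.1. Qed.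
Let mim : measurable_fun setT (fun x => Im (g x)). Proof. exact: gL2.1.2. Qed.

Let i2 : mu.-integrable setT (fun x => (cabs2 (g x))%:E).
Proof.
apply/integrableP; split; first by apply: measurable_fun_EFin; apply: measurable_cabs2; exact: gL2.1.
under eq_integral do rewrite gee0_abs ?lee_fin ?cabs2_ge0//.
exact: gL2.2.
Qed.

(** Square integrable functions are integrable on a bounded interval, because |u| <= 1 + u^2. *)
Let dom_integrable (u : R -> R) : measurable_fun setT u ->
  (forall x, u x ^+ 2 <= cabs2 (g x)) -> mu.-integrable setT (EFin \o u \_ D).
Proof.
move=> mu_ uu.
apply: (@le_integrable _ _ _ mu _ measurableT _ (EFin \o (fun x => \1_D x + cabs2 (g x)))) => //.
- apply: measurable_fun_EFin; apply: (iffLR (measurable_restrictT u mD)).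
  exact: measurable_funS mu_.
- move=> x _; rewrite /= lee_fin [leRHS]ger0_norm; last by apply: addr_ge0 => //; exact: cabs2_ge0.
  rewrite patchE indicE; case: ifP => _; last by rewrite normr0 add0r cabs2_ge0.
  have := uu x; rewrite -[X in X <= _]real_normK ?num_real//.
  have := sqr_ge0 (`|u x| - 1); rewrite !expr2 /=; have := normr_ge0 (u x); lra.
- have i1 : mu.-integrable setT (EFin \o \1_D) by exact: integrable_indic_itv.
  exact: (integrableD measurableT i1 i2).
Qed.

Lemma integrable_trunc_re : mu.-integrable setT (EFin \o trunc_re).
Proof. by apply: dom_integrable => // x; rewrite /cabs2 lerDl sqr_ge0. Qed.

Lemma integrable_trunc_im : mu.-integrable setT (EFin \o trunc_im).
Proof. by apply: dom_integrable => // x; rewrite /cabs2 lerDr sqr_ge0. Qed.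

Let bdd_integrable (u w : R -> R) : mu.-integrable setT (EFin \o u) ->
  measurable_fun setT w -> (forall x, `|w x| <= 1) ->
  mu.-integrable setT (EFin \o (fun x => u x * w x)).
Proof.
move=> iu mw w1; apply: (@le_integrable _ _ _ mu _ measurableT _ (EFin \o u)) => //.
- apply: measurable_fun_EFin; apply: measurable_funM => //.
  by apply/measurable_EFinP; exact: measurable_int iu.
- by move=> x _; rewrite /= lee_fin normrM ler_piMr.
Qed.

Let mcos k : measurable_fun setT (fun x : R => cos (k * x)).
Proof. exact: (measurableT_comp (@measurable_fun_cos R) (@mulrl_measurable R setT k)). Qed.
Let msin k : measurable_fun setT (fun x : R => sin (k * x)).
Proof. exact: (measurableT_comp (@measurable_fun_sin R) (@mulrl_measurable R setT k)). Qed.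

Let icos u k : mu.-integrable setT (EFin \o u) ->
  mu.-integrable setT (EFin \o (fun x => u x * cos (k * x))).
Proof. by move=> iu; apply: bdd_integrable => // x; exact: cos_max. Qed.
Let isin u k : mu.-integrable setT (EFin \o u) ->
  mu.-integrable setT (EFin \o (fun x => u x * sin (k * x))).
Proof. by move=> iu; apply: bdd_integrable => // x; exact: sin_max. Qed.

Let Ct u k := \int[mu]_x (u x * cos (k * x)).
Let St u k := \int[mu]_x (u x * sin (k * x)).

Let CtN u k : Ct u (- k) = Ct u k.
Proof. by apply: eq_Rintegral => x _; rewrite mulNr cosN. Qed.
Let StN u k : mu.-integrable setT (EFin \o u) -> St u (- k) = - St u k.
Proof.
move=> iu; rewrite -[RHS]mulN1r /St -RintegralZl//; last exact: isin.
by apply: eq_Rintegral => x _; rewrite mulNr sinN mulrN mulN1r.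
Qed.

Let hartleyE u k : mu.-integrable setT (EFin \o u) -> hartley u k = Ct u k + St u k.
Proof.
move=> iu; rewrite /Ct /St -(RintegralD measurableT (icos k iu) (isin k iu)).
by apply: eq_Rintegral => x _; rewrite mulrDr.
Qed.

Let ReF k : Re (trunc_fourier g N k) = Ct trunc_re k + St trunc_im k.
Proof.
rewrite /Ct /St -(RintegralD measurableT (icos k integrable_trunc_re) (isin k integrable_trunc_im)).
rewrite /trunc_fourier /= Rintegral_mkcond; apply: eq_Rintegral => x _.
rewrite /trunc_re /trunc_im !patchE; case: ifP => _; rewrite ?mul0r ?addr0 ?subr0//.
by rewrite [cos _ * _]mulrC [sin _ * _]mulrC.
Qed.

Let ImF k : Im (trunc_fourier g N k) = Ct trunc_im k - St trunc_re k.
Proof.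
rewrite /Ct /St -(RintegralB measurableT (icos k integrable_trunc_im) (isin k integrable_trunc_re)).
rewrite /trunc_fourier /= Rintegral_mkcond; apply: eq_Rintegral => x _.
rewrite /trunc_re /trunc_im !patchE; case: ifP => _; rewrite ?mul0r ?addr0 ?subr0//.
by rewrite [cos _ * _]mulrC [sin _ * _]mulrC.
Qed.

Lemma cmeasurable_trunc_fourier : cmeasurable (trunc_fourier g N).
Proof.
have m12 : measurable_fun setT (fun zx : R * R => zx.1 * zx.2).
  by apply: measurable_funM; [exact: measurable_fst|exact: measurable_snd].
have mu_ u : mu.-integrable setT (EFin \o u) ->
    measurable_fun setT (Ct u) /\ measurable_fun setT (St u).
  move=> iu; have mu_ : measurable_fun setT u by apply/measurable_EFinP; exact: measurable_int iu.
  split.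
    apply: (@measurable_fun_Rintegral R (fun zx => u zx.2 * cos (zx.1 * zx.2))).
    apply: measurable_funM; first exact: (measurableT_comp mu_ measurable_snd).
    exact: (measurableT_comp (@measurable_fun_cos R) m12).
  apply: (@measurable_fun_Rintegral R (fun zx => u zx.2 * sin (zx.1 * zx.2))).
  apply: measurable_funM; first exact: (measurableT_comp mu_ measurable_snd).
  exact: (measurableT_comp (@measurable_fun_sin R) m12).
have [mCr mSr] := mu_ _ integrable_trunc_re; have [mCi mSi] := mu_ _ integrable_trunc_im.
split.
  by have /funext E := ReF; rewrite E; exact: measurable_funD.
by have /funext E := ImF; rewrite E; exact: measurable_funB.
Qed.

(* Even and odd parts of F recover the transforms of Re g and Im g; hence the
   reflected frequency - k. *)
Let hartley_trunc k :
  hartley trunc_re k ^+ 2 + hartley trunc_im k ^+ 2 <=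
  cabs2 (trunc_fourier g N k) + cabs2 (trunc_fourier g N (- k)).
Proof.
rewrite !hartleyE ?integrable_trunc_re ?integrable_trunc_im//.
rewrite /cabs2 !ReF !ImF !CtN !StN ?integrable_trunc_re ?integrable_trunc_im//.
move: (Ct trunc_re k) (Ct trunc_im k) (St trunc_re k) (St trunc_im k) => a b c d.
have := sqr_ge0 (a - c); have := sqr_ge0 (b - d).
rewrite !expr2; lra.
Qed.

(** The Hartley bounds for the real and imaginary parts are added. The reflected transform has the
    same L^2 norm, so the constant 1 / (2 cF) doubles to 1 / cF. *)
Lemma trunc_integral_le :
  (\int[mu]_(x in D) (cabs2 (g x))%:E <= cF^-1%:E * L2norm2 (trunc_fourier g N))%E.
Proof.
have sup (u : R -> R) x : (u \_ D) x != 0 -> `|x| <= N%:R.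
  rewrite patchE; case: ifP => [|_]; last by rewrite eqxx.
  by rewrite /D mem_setE in_itv/= ler_norml => ->.
have mreT : measurable_fun setT trunc_re.
  by apply/measurable_EFinP; exact: measurable_int integrable_trunc_re.
have mimT : measurable_fun setT trunc_im.
  by apply/measurable_EFinP; exact: measurable_int integrable_trunc_im.
have c0 := fejer_mass_gt0 R.
have mF : measurable_fun setT (fun k : R => cabs2 (trunc_fourier g N k)).
  by apply: measurable_cabs2; exact: cmeasurable_trunc_fourier.
have mFN : measurable_fun setT (fun k : R => cabs2 (trunc_fourier g N (- k))).
  exact: measurableT_comp mF (@oppr_measurable R setT).
have -> : (\int[mu]_(x in D) (cabs2 (g x))%:E =
    \int[mu]_x ((trunc_re x ^+ 2)%:E + (trunc_im x ^+ 2)%:E))%E.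
  rewrite integral_mkcond; apply: eq_integral => x _.
  by rewrite /trunc_re /trunc_im !patchE; case: ifP => _ //; rewrite expr0n/= adde0.
rewrite ge0_integralD//=; first last.
- by apply: measurable_fun_EFin; exact: measurable_funX.
- by move=> x _; rewrite lee_fin sqr_ge0.
- by apply: measurable_fun_EFin; exact: measurable_funX.
- by move=> x _; rewrite lee_fin sqr_ge0.
apply: (le_trans (leeD (sqr_integral_le_hartley integrable_trunc_re (@sup (fun x => Re (g x))))
  (sqr_integral_le_hartley integrable_trunc_im (@sup (fun x => Im (g x)))))).
rewrite -ge0_muleDr ?integral_ge0//; last 2 first.
- by move=> x _; rewrite lee_fin sqr_ge0.
- by move=> x _; rewrite lee_fin sqr_ge0.
rewrite -ge0_integralD//=; first last.
- by apply: measurable_fun_EFin; apply: measurable_funX; apply: measurable_hartley; exact: integrable_trunc_im.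
- by move=> x _; rewrite lee_fin sqr_ge0.
- by apply: measurable_fun_EFin; apply: measurable_funX; apply: measurable_hartley; exact: integrable_trunc_re.
- by move=> x _; rewrite lee_fin sqr_ge0.
apply: (@le_trans _ _ ((2 * cF)^-1%:E * \int[mu]_k ((cabs2 (trunc_fourier g N k))%:E + (cabs2 (trunc_fourier g N (- k)))%:E))%E).
  apply: lee_wpmul2l; first by rewrite lee_fin invr_ge0 mulr_ge0// ltW.
  apply: ge0_le_integral => //=.
  - by move=> x _; rewrite -EFinD lee_fin addr_ge0 ?sqr_ge0.
  - apply: emeasurable_funD; apply: measurable_fun_EFin; apply: measurable_funX; apply: measurable_hartley.
      exact: integrable_trunc_re.
    exact: integrable_trunc_im.
  - by apply: emeasurable_funD; exact: measurable_fun_EFin.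
  - by move=> k _; rewrite -!EFinD lee_fin; exact: hartley_trunc.
rewrite ge0_integralD//=; first last.
- exact: measurable_fun_EFin.
- by move=> x _; rewrite lee_fin cabs2_ge0.
- exact: measurable_fun_EFin.
- by move=> x _; rewrite lee_fin cabs2_ge0.
rewrite (@ge0_integral_opp R (fun k : R => cabs2 (trunc_fourier g N k)))//; last by move=> k; exact: cabs2_ge0.
rewrite -/(L2norm2 _).
have L0 : (0 <= L2norm2 (trunc_fourier g N))%E.
  by apply: integral_ge0 => x _; rewrite lee_fin cabs2_ge0.
rewrite -[X in (X + _)%E]mul1e -[X in (_ + X)%E]mul1e -ge0_muleDl// muleA -EFinD -EFinM.
by rewrite le_eqVlt; apply/orP; left; apply/eqP; congr (_%:E * _)%E; field; rewrite gt_eqF.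
Qed.

End trunc.

(** The truncated integrals of |g|^2 increase to the full one, while the truncated transforms
    converge in L^2. Bounding them through [cabs2_triangle] costs the factor 2. *)
Lemma L2norm2_le_fourier (g gh : R -> R[i]) :
  is_fourier g gh -> (L2norm2 g <= (2 / cF)%:E * L2norm2 gh)%E.
Proof.
move=> [gL2 [ghL2 gcv]].
have c0 := fejer_mass_gt0 R.
have mg := measurable_cabs2 gL2.1.
have mgh := measurable_cabs2 ghL2.1.
pose D (N : nat) := `[- N%:R, N%:R]%classic : set R.
have ndD : nondecreasing_seq D.
  move=> m n mn; apply/subsetPset => x; rewrite /D /= !in_itv/= => /andP[x1 x2].
  have : (m%:R : R) <= n%:R by rewrite ler_nat.
  by move=> mn'; apply/andP; split; lra.
have UD : \bigcup_N D N = setT.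
  apply/seteqP; split => // x _; exists (Num.truncn `|x|).+1 => //.
  by rewrite /D /= in_itv/= -ler_norml ltW// truncnS_gt.
have cvD : (\int[mu]_(x in D N) (cabs2 (g x))%:E @[N --> \oo] --> L2norm2 g)%E.
  rewrite /L2norm2 -UD; apply: ge0_nondecreasing_set_cvg_integral => //.
  - by move=> N; exact: measurable_itv.
  - by move=> N; apply: measurable_fun_EFin; exact: measurable_funS mg.
  - by move=> N x _; rewrite lee_fin cabs2_ge0.
pose B N := ((2 / cF)%:E * (L2norm2 (fun k : R => trunc_fourier g N k - gh k)%R + L2norm2 gh))%E.
have cvB : B N @[N --> \oo] --> ((2 / cF)%:E * L2norm2 gh)%E.
  apply: cvgeZl => //; rewrite -[X in _ --> X]add0e.
  by apply: cvgeD => //; exact: cvg_cst.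
apply: (lee_cvg_to cvD cvB); apply: nearW => N.
apply: (le_trans (trunc_integral_le N gL2)).
have mF := cmeasurable_trunc_fourier N gL2.
have mS : cmeasurable (fun k : R => trunc_fourier g N k - gh k).
  split.
    rewrite (_ : (fun x => _) = (fun k : R => Re (trunc_fourier g N k) - Re (gh k))).
      by apply: measurable_funB; [exact: mF.1|exact: ghL2.1.1].
    by apply/funext => k; case: (trunc_fourier _ _ _); case: (gh k).
  rewrite (_ : (fun x => _) = (fun k : R => Im (trunc_fourier g N k) - Im (gh k))).
    by apply: measurable_funB; [exact: mF.2|exact: ghL2.1.2].
  by apply/funext => k; case: (trunc_fourier _ _ _); case: (gh k).
rewrite /B mulrC EFinM -muleA; apply: lee_wpmul2l; first by rewrite lee_fin invr_ge0 ltW.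
rewrite /L2norm2 -ge0_integralD//=; first last.
- exact: measurable_fun_EFin.
- by move=> x _; rewrite lee_fin cabs2_ge0.
- by apply: measurable_fun_EFin; exact: measurable_cabs2.
- by move=> x _; rewrite lee_fin cabs2_ge0.
rewrite -ge0_integralZl//=; first last.
- by move=> x _; rewrite -EFinD lee_fin addr_ge0 ?cabs2_ge0.
- by apply: emeasurable_funD; apply: measurable_fun_EFin => //; exact: measurable_cabs2.
apply: ge0_le_integral => //=.
- by move=> x _; rewrite lee_fin cabs2_ge0.
- by apply: measurable_fun_EFin; exact: measurable_cabs2.
- apply: measurable_funeM; apply: emeasurable_funD; apply: measurable_fun_EFin => //.
  exact: measurable_cabs2.
- by move=> k _; rewrite -EFinD -EFinM lee_fin mulrDr; exact: cabs2_triangle.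
Qed.
End Plancherel.

(** * The matrix exponential as a solution of the linear system *)

Section ExpSeries.
Variable R : realType.

Lemma is_cvg_exp_pseries (c : nat -> R) (B D x : R) :
  (forall l, `|c l| <= D * B ^+ l) ->
  cvgn (pseries (fun l => c l / l`!%:R) x).
Proof.
move=> cB.
have D0 : 0 <= D by have := cB 0%N; rewrite expr0 mulr1; apply: le_trans.
apply: normed_cvg.
apply: (series_le_cvg (v_ := fun l => D * exp_coeff (`|B| * `|x|) l)).
- by move=> l; exact: normr_ge0.
- by move=> l; rewrite mulr_ge0// exp_coeff_ge0// mulr_ge0.
- move=> l /=; rewrite /exp_coeff /= !normrM normfV normr_nat normrX exprMn.
  rewrite [leRHS](_ : _ = (D * `|B| ^+ l) / l`!%:R * `|x| ^+ l); last by ring.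
  rewrite ler_wpM2r ?exprn_ge0// ler_wpM2r ?invr_ge0//.
  rewrite (le_trans (cB l))// ler_wpM2l// -normrX; exact: ler_norm.
- exact: (is_cvg_seriesZ (k := D) (is_cvg_series_exp_coeff (`|B| * `|x|))).
Qed.

(** Division by l! turns formal differentiation into a shift of [c], which preserves geometric
    bounds. Termwise differentiation needs the series and its first two formal derivatives to
    converge at a point beyond |x|, here |x| + 1. *)
Lemma is_derive_exp_pseries (c : nat -> R) (B D x : R) :
  (forall l, `|c l| <= D * B ^+ l) ->
  is_derive x 1 (fun x => limn (pseries (fun l => c l / l`!%:R) x))
    (limn (pseries (fun l => c l.+1 / l`!%:R) x)).
Proof.
move=> cB.
have dE (c' : nat -> R) : pseries_diffs (fun l => c' l / l`!%:R) = (fun l => c' l.+1 / l`!%:R).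
  apply/funext => l; rewrite /pseries_diffs factS natrM.
  by rewrite invfM mulrCA mulVKf// pnatr_eq0.
have cB1 l : `|c l.+1| <= (D * B) * B ^+ l by rewrite -mulrA -exprS.
have cB2 l : `|c l.+2| <= (D * B * B) * B ^+ l by rewrite -!mulrA -!exprS.
have xK : `|x| < `| `|x| + 1 | by rewrite [ltRHS]ger0_norm ?addr_ge0// ltrDl.
have := @pseries_snd_diffs R (fun l => c l / l`!%:R) (`|x| + 1) x.
rewrite !dE; apply => //.
- exact: is_cvg_exp_pseries cB.
- exact: (@is_cvg_exp_pseries (fun l => c l.+1) _ _ (`|x| + 1) cB1).
- exact: (@is_cvg_exp_pseries (fun l => c l.+2) _ _ (`|x| + 1) cB2).
Qed.

End ExpSeries.

(** * Derivative of the matrix exponential *)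

Section CplxDerive.
Variable R : realType.
Local Open Scope complex_scope.
Local Notation C := R[i].
Local Notation Re := (@complex.Re R).
Local Notation Im := (@complex.Im R).

Lemma ReD (x y : C) : Re (x + y) = Re x + Re y. Proof. by case: x; case: y. Qed.
Lemma ImD (x y : C) : Im (x + y) = Im x + Im y. Proof. by case: x; case: y. Qed.
Lemma ReM (x y : C) : Re (x * y) = Re x * Re y - Im x * Im y.
Proof. by case: x; case: y. Qed.
Lemma ImM (x y : C) : Im (x * y) = Re x * Im y + Im x * Re y.
Proof. by case: x => a b; case: y => c d /=; rewrite addrC. Qed.
Lemma Re_sum I (r : seq I) (P : pred I) (F : I -> C) :
  Re (\sum_(i <- r | P i) F i) = \sum_(i <- r | P i) Re (F i).
Proof. by apply: (big_morph _ ReD). Qed.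
Lemma Im_sum I (r : seq I) (P : pred I) (F : I -> C) :
  Im (\sum_(i <- r | P i) F i) = \sum_(i <- r | P i) Im (F i).
Proof. by apply: (big_morph _ ImD). Qed.

(** A submultiplicative, real-valued norm that dominates both |Re z| and |Im z|. *)
Definition norm1c (z : C) : R := `|Re z| + `|Im z|.

Lemma norm1cD x y : norm1c (x + y) <= norm1c x + norm1c y.
Proof.
rewrite /norm1c ReD ImD.
have := ler_normD (Re x) (Re y); have := ler_normD (Im x) (Im y); lra.
Qed.

Lemma norm1cM x y : norm1c (x * y) <= norm1c x * norm1c y.
Proof.
rewrite /norm1c ReM ImM.
have := ler_normB (Re x * Re y) (Im x * Im y).
have := ler_normD (Re x * Im y) (Im x * Re y).
rewrite !normrM; lra.
Qed.

Lemma norm1c_ge0 x : 0 <= norm1c x. Proof. exact: addr_ge0. Qed.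

Lemma norm1c_sum I (r : seq I) (P : pred I) (F : I -> C) :
  norm1c (\sum_(i <- r | P i) F i) <= \sum_(i <- r | P i) norm1c (F i).
Proof.
elim/big_ind2: _ => //; first by rewrite /norm1c /= normr0 addr0.
move=> a a' b b' h h'; apply: (le_trans (norm1cD _ _)); exact: lerD.
Qed.

(** The sum over all entries dominates every row sum, which gives the induction step. *)
Lemma mxpow_le m (M : 'M[C]_m) l i j :
  norm1c (mxpow M l i j) <= (\sum_p \sum_q norm1c (M p q)) ^+ l.
Proof.
elim: l i j => [|l IH] i j.
  rewrite /mxpow /= mxE expr0 /norm1c; case: (i == j) => /=; rewrite ?normr0 ?normr1 ?addr0//.
set B := \sum_p _ in IH *.
have B0 : 0 <= B by apply: sumr_ge0 => p _; apply: sumr_ge0 => q _; exact: norm1c_ge0.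
rewrite /mxpow iterS -/(mxpow M l) mxE exprS.
apply: (le_trans (norm1c_sum _ _ _)).
apply: (@le_trans _ _ (\sum_q norm1c (M i q) * B ^+ l)).
  apply: ler_sum => q _; apply: (le_trans (norm1cM _ _)).
  by apply: ler_wpM2l; [exact: norm1c_ge0|exact: IH].
rewrite -mulr_suml ler_wpM2r ?exprn_ge0//.
rewrite /B [leRHS](bigD1 i)//= lerDl; apply: sumr_ge0 => p _; apply: sumr_ge0 => q _; exact: norm1c_ge0.
Qed.

Definition cderive (z : R -> C) (t : R) (d : C) :=
  is_derive t 1 (fun s => Re (z s)) (Re d) /\ is_derive t 1 (fun s => Im (z s)) (Im d).

Lemma mxpowZ m (M : 'M[C]_m) (t : R) l : mxpow (t%:C *: M) l = (t ^+ l)%:C *: mxpow M l.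
Proof.
elim: l => [|l IH]; first by rewrite /mxpow /= expr0 scale1r.
rewrite /mxpow !iterS -!/(mxpow _ l) IH -scalemxAl -scalemxAr scalerA exprS.
by rewrite rmorphM.
Qed.

Lemma mxexp_partialE m (M : 'M[C]_m) (t : R) N i j :
  mxexp_partial (t%:C *: M) N i j =
  \sum_(l < N) (t ^+ l / l`!%:R)%:C * mxpow M l i j.
Proof.
rewrite /mxexp_partial summxE; apply: eq_bigr => l _.
rewrite mxE mxpowZ mxE mulrA; congr (_ * _).
by rewrite rmorphM mulrC fmorphV rmorph_nat.
Qed.

(** Each entry of exp(tM) thus becomes a pair of real power series in t, as [is_derive_exp_pseries]
    requires. *)
Lemma mxexp_ReE m (M : 'M[C]_m) (t : R) i j :
  Re (mxexp (t%:C *: M) i j) = limn (pseries (fun l => Re (mxpow M l i j) / l`!%:R) t).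
Proof.
rewrite /mxexp mxE /=.
suff -> : (fun N => Re (mxexp_partial (t%:C *: M) N i j)) =
  pseries (fun l => Re (mxpow M l i j) / l`!%:R) t by [].
apply/funext => N; rewrite mxexp_partialE Re_sum /pseries /series /= big_mkord.
apply: eq_bigr => l _; rewrite ReM /= mul0r subr0; ring.
Qed.

Lemma mxexp_ImE m (M : 'M[C]_m) (t : R) i j :
  Im (mxexp (t%:C *: M) i j) = limn (pseries (fun l => Im (mxpow M l i j) / l`!%:R) t).
Proof.
rewrite /mxexp mxE /=.
suff -> : (fun N => Im (mxexp_partial (t%:C *: M) N i j)) =
  pseries (fun l => Im (mxpow M l i j) / l`!%:R) t by [].
apply/funext => N; rewrite mxexp_partialE Im_sum /pseries /series /= big_mkord.
apply: eq_bigr => l _; rewrite ImM /= mul0r addr0; ring.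
Qed.

(** The differentiated series has the powers M^(l+1) = M M^l as coefficients, hence sums to M
    exp(tM). *)
Lemma cderive_mxexp m (M : 'M[C]_m) (t : R) i j :
  cderive (fun s => mxexp (s%:C *: M) i j) t ((M *m mxexp (t%:C *: M)) i j).
Proof.
set B := \sum_p \sum_q norm1c (M p q).
have bR p q l : `|Re (mxpow M l p q)| <= 1 * B ^+ l.
  by rewrite mul1r (le_trans _ (mxpow_le M l p q))// lerDl.
have bI p q l : `|Im (mxpow M l p q)| <= 1 * B ^+ l.
  by rewrite mul1r (le_trans _ (mxpow_le M l p q))// lerDr.
have cR p q := is_cvg_exp_pseries (x := t) (bR p q).
have cI p q := is_cvg_exp_pseries (x := t) (bI p q).
(* The real or imaginary part of a row of [M] times a column is a finite real combination, through
   which the limit passes. *)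
have limE (u v : 'I_m -> R) (p q : 'I_m -> nat -> R) (e : nat -> R) :
    (forall k, cvgn (pseries (p k) t)) -> (forall k, cvgn (pseries (q k) t)) ->
    (forall l, e l = \sum_k (u k * p k l + v k * q k l)) ->
    limn (pseries e t) = \sum_k (u k * limn (pseries (p k) t) + v k * limn (pseries (q k) t)).
  move=> cp cq eE.
  have -> : pseries e t = fun N => \sum_k (u k * pseries (p k) t N + v k * pseries (q k) t N).
    apply/funext => N; rewrite /pseries /series /=.
    under eq_bigr do rewrite eE mulr_suml.
    rewrite exchange_big /=; apply: eq_bigr => k _.
    rewrite !mulr_sumr -big_split /=; apply: eq_bigr => l _; ring.
  apply: cvg_lim => //.
  apply: cvg_big => [|k _]; first exact: add_continuous.
  by apply: cvgD; apply: cvgMl_tmp.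
split.
- have -> : Re ((M *m mxexp (t%:C *: M)) i j) =
      limn (pseries (fun l => Re (mxpow M l.+1 i j) / l`!%:R) t).
    rewrite mxE Re_sum.
    rewrite (limE (fun k => Re (M i k)) (fun k => - Im (M i k))
      (fun k l => Re (mxpow M l k j) / l`!%:R) (fun k l => Im (mxpow M l k j) / l`!%:R)) //.
      by apply: eq_bigr => k _; rewrite ReM mxexp_ReE mxexp_ImE mulNr.
    move=> l; rewrite /mxpow iterS -/(mxpow M l) mxE Re_sum mulr_suml.
    by apply: eq_bigr => k _; rewrite ReM; ring.
  have -> : (fun s => Re (mxexp (s%:C *: M) i j)) =
      (fun s => limn (pseries (fun l => Re (mxpow M l i j) / l`!%:R) s)).
    by apply/funext => s; rewrite mxexp_ReE.
  exact: (@is_derive_exp_pseries R _ B 1 t (bR i j)).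
- have -> : Im ((M *m mxexp (t%:C *: M)) i j) =
      limn (pseries (fun l => Im (mxpow M l.+1 i j) / l`!%:R) t).
    rewrite mxE Im_sum.
    rewrite (limE (fun k => Im (M i k)) (fun k => Re (M i k))
      (fun k l => Re (mxpow M l k j) / l`!%:R) (fun k l => Im (mxpow M l k j) / l`!%:R)) //.
      by apply: eq_bigr => k _; rewrite ImM mxexp_ReE mxexp_ImE addrC.
    move=> l; rewrite /mxpow iterS -/(mxpow M l) mxE Im_sum mulr_suml.
    by apply: eq_bigr => k _; rewrite ImM; ring.
  have -> : (fun s => Im (mxexp (s%:C *: M) i j)) =
      (fun s => limn (pseries (fun l => Im (mxpow M l i j) / l`!%:R) s)).
    by apply/funext => s; rewrite mxexp_ImE.
  exact: (@is_derive_exp_pseries R _ B 1 t (bI i j)).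
Qed.

Lemma mxexp0 m (M : 'M[C]_m) : mxexp (0%:C *: M) = 1%:M.
Proof.
have lim0 (c : nat -> R) : limn (pseries c 0) = c 0%N.
  (* The partial sum of length 0 is empty; the sequence is constant from length 1 on. *)
  apply: cvg_lim => //; rewrite -(cvg_shiftn 1) /=.
  rewrite (_ : (fun _ => _) = cst (c 0%N)); first exact: cvg_cst.
  apply/funext => N; rewrite /pseries /series /= addn1 big_mkord big_ord_recl /= expr0 mulr1.
  by rewrite big1 ?addr0// => l _; rewrite /= expr0n/= mulr0.
apply/matrixP => i j; rewrite [LHS]complexE.
apply/eqP; rewrite eq_complex; apply/andP; split; apply/eqP.
- rewrite -[X in X%:C]/(Re _) -[in X in 'i * X]/(Im _) -complexE mxexp_ReE lim0 fact0 divr1.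
  by rewrite /mxpow.
- rewrite -complexE mxexp_ImE lim0 fact0 divr1.
  by rewrite /mxpow.
Qed.
End CplxDerive.

(** * Layer forms and energy *)

Section Tridiag.
Variable R : realType.

(* u_1, ..., u_n extended by the boundary values u_0 = u_(n+1) = 0. *)
Definition bext n (u : 'I_n -> R) (j : nat) : R :=
  if j is j'.+1 then (if insub j' is Some i then u i else 0) else 0.

#[local] Arguments bext : simpl never.

Lemma bext0 n (u : 'I_n -> R) : bext u 0 = 0. Proof. by []. Qed.

Lemma bextS n (u : 'I_n -> R) (i : 'I_n) : bext u i.+1 = u i.
Proof. by rewrite /bext valK. Qed.

Lemma bext_last n (u : 'I_n -> R) : bext u n.+1 = 0.
Proof. by rewrite /bext insubF// ltnn. Qed.

Lemma bextE n (u : 'I_n -> R) m : bext u m = \sum_(j < n) (j.+1 == m :> nat)%:R * u j.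
Proof.
case: m => [|m]; first by rewrite big1 // => j _; rewrite mul0r.
rewrite /bext; case: insubP => [i _ <-|].
  rewrite (bigD1 i)//= eqxx mul1r big1 ?addr0// => j ji.
  by rewrite eqSS (inj_eq val_inj) (negbTE ji) mul0r.
rewrite -leqNgt => nm; rewrite big1// => j _.
by rewrite eqSS ltn_eqF ?mul0r// (leq_trans (ltn_ord j)).
Qed.

(* Contribution of the j-th layer to the tridiagonal form, a = u_j, b = u_(j+1). *)
Definition layer_form (p r a b a' b' : R) : R :=
  p * (a * a' + b * b') - r * (a * b' + b * a').

Lemma tridiag_rowE n (d o : nat -> R) (v : 'I_n -> R) (i : 'I_n) :
  \sum_j tridiag n d o i j * v j =
  o i.-1 * bext v i + d i * v i + o i * bext v i.+2.
Proof.
rewrite !bextE (bigD1 i)//= !mulr_sumr.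
rewrite [in RHS](bigD1 i)//= [X in _ = _ + X](bigD1 i)//=.
rewrite (gtn_eqF (ltnSn i)) (ltn_eqF (ltnSn i.+1)) !mul0r !mulr0 !add0r mxE eqxx addrC -addrA [_ + \sum_(_ | _) _]addrC addrA.
congr (_ + _); rewrite -big_split/=; apply: eq_bigr => j ji; rewrite mxE eq_sym (negbTE ji).
rewrite eqSS [(j == i.+1 :> nat)]eq_sym.
have [ij|ij] := eqVneq (i.+1) j.
  by rewrite /= -ij gtn_eqF ?leqnSn// mul0r mulr0 add0r mul1r (minn_idPl _).
have [ji1|ji1] := eqVneq (j.+1) i; last by rewrite /= !mul0r !mulr0 addr0.
by rewrite /= -ji1 /= mul1r mul0r mulr0 addr0 (minn_idPr _).
Qed.

(** Matrix index i stands for the unknown u_(i+1), which borders layers i and i + 1. Splitting each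
    layer form into the terms carrying u_j and those carrying u_(j+1), and shifting the former by
    one, collects the rows of the matrix. *)
Lemma tridiag_form n (e : R) (p r : nat -> R) (u v : 'I_n -> R) :
  \sum_i u i * \sum_j tridiag n (fun i => e + (p i + p i.+1)) (fun i => - r i.+1) i j * v j =
  e * (\sum_i u i * v i) +
  \sum_(j < n.+1) layer_form (p j) (r j) (bext u j) (bext u j.+1) (bext v j) (bext v j.+1).
Proof.
under eq_bigr do rewrite tridiag_rowE.
have -> : \sum_(j < n.+1) layer_form (p j) (r j) (bext u j) (bext u j.+1) (bext v j) (bext v j.+1) =
  \sum_(j < n.+1) (p j * (bext u j * bext v j) - r j * (bext u j * bext v j.+1)) +
  \sum_(j < n.+1) (p j * (bext u j.+1 * bext v j.+1) - r j * (bext u j.+1 * bext v j)).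
  by rewrite -big_split /=; apply: eq_bigr => j _; rewrite /layer_form; ring.
rewrite [X in _ = _ + (X + _)]big_ord_recl [X in _ = _ + (_ + X)]big_ord_recr /=.
rewrite !bext_last !bext0 !mul0r !mulr0 subrr add0r addr0.
under [X in _ = _ + (X + _)]eq_bigr do rewrite /bump leq0n add1n.
rewrite mulr_sumr -!big_split /=; apply: eq_bigr => i _.
rewrite !bextS.
(* At i = 0 the predecessor is the default 0, but there [bext v 0] = 0. *)
have -> : - r i.-1.+1 * bext v i = - r i * bext v i.
  by case: (i : nat) => [|m] //=; rewrite !mulr0.
ring.
Qed.

Lemma sum_sqr_bext n (u : 'I_n -> R) :
  \sum_(j < n.+1) (bext u j ^+ 2 + bext u j.+1 ^+ 2) = 2 * \sum_i u i ^+ 2.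
Proof.
rewrite big_split /= [X in X + _ = _]big_ord_recl [X in _ + X = _]big_ord_recr /= bext_last bext0 expr0n /= add0r addr0.
under eq_bigr do rewrite /bump leq0n add1n.
under eq_bigr do rewrite bextS.
by rewrite mulr_natl mulr2n.
Qed.

(** Starting from u_0 = 0, the inequality u_(m+1)^2 <= 2 u_m^2 + 2 (u_(m+1) - u_m)^2 gives u_m^2 <=
    (2^m - 1) 2S by induction. *)
Lemma bext_poincare n (u : 'I_n -> R) :
  \sum_i u i ^+ 2 <= (n%:R * 2 ^+ n) * (2 * \sum_(j < n.+1) (bext u j.+1 - bext u j) ^+ 2).
Proof.
set S := \sum_(j < n.+1) _.
have S0 : 0 <= S by apply: sumr_ge0 => j _; exact: sqr_ge0.
have H m : (m <= n)%N -> bext u m ^+ 2 <= (2 ^+ m - 1) * (2 * S).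
  elim: m => [_|m IH mn]; first by rewrite bext0 expr0n /= expr0 subrr mul0r.
  have dS : (bext u m.+1 - bext u m) ^+ 2 <= S.
    rewrite /S (bigD1 (Ordinal (ltnW mn : (m < n.+1)%N)))//= lerDl.
    by apply: sumr_ge0 => j _; exact: sqr_ge0.
  have := IH (ltnW mn); have -> : 2 ^+ m.+1 = 2 * 2 ^+ m :> R by rewrite exprS.
  have : bext u m.+1 ^+ 2 <= 2 * bext u m ^+ 2 + 2 * (bext u m.+1 - bext u m) ^+ 2.
    have := sqr_ge0 (bext u m.+1 - 2 * bext u m).
    rewrite !expr2; lra.
  lra.
rewrite -mulrA mulr_natl -[X in _ *+ X]card_ord -sumr_const.
apply: ler_sum => i _; rewrite -bextS (le_trans (H _ (ltn_ord i)))//.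
apply: ler_wpM2r; first by rewrite mulr_ge0.
have : (2 : R) ^+ i.+1 <= 2 ^+ n by rewrite ler_eXn2l ?ltr1n.
lra.
Qed.

End Tridiag.
Arguments bext : simpl never.

(** * Bounds for k coth(k d), k csch(k d) and the layer forms *)

Section Layers.
Variable R : realType.

Lemma sinhR_gt0 (x : R) : 0 < x -> 0 < sinhR x.
Proof. by move=> x0; rewrite /sinhR divr_gt0// subr_gt0 ltr_expR; lra. Qed.

Lemma sinhRN (x : R) : sinhR (- x) = - sinhR x.
Proof. by rewrite /sinhR opprK -mulNr opprB. Qed.

Lemma coshRN (x : R) : coshR (- x) = coshR x.
Proof. by rewrite /coshR opprK addrC. Qed.

Lemma coshR_ge1 (x : R) : 1 <= coshR x.
Proof. by rewrite /coshR; have := expR_ge1Dx x; have := expR_ge1Dx (- x); lra. Qed.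

Lemma expR_mulN (x : R) : expR x * expR (- x) = 1.
Proof. by rewrite -expRD subrr expR0. Qed.

(** As cosh x - sinh x = e^(-x), the claim is x e^(-x) <= sinh x, that is 1 + 2x <= e^(2x). *)
Lemma cothR_le (x : R) : 0 < x -> x * cothR x <= 1 + x.
Proof.
move=> x0; rewrite /cothR mulrA ler_pdivrMr ?sinhR_gt0//.
have e2 : 1 + (x + x) <= expR x * expR x by rewrite -expRD expR_ge1Dx.
have eN := expR_mulN x; have eN0 := expR_gt0 (- x).
rewrite /coshR /sinhR.
have : 2 * x * expR (- x) <= expR x - expR (- x).
  have := ler_wpM2r (ltW eN0) e2.
  rewrite -[expR x * expR x * _]mulrA eN; lra.
lra.
Qed.

Lemma sinhR_le (x : R) : 0 < x -> sinhR x <= x * expR x.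
Proof.
move=> x0.
have e2 : 1 + (- x - x) <= expR (- x) * expR (- x) by rewrite -expRD expR_ge1Dx.
have eN := expR_mulN x; have e0 := expR_gt0 x.
have := ler_wpM2l (ltW e0) e2; rewrite mulrA eN /sinhR; lra.
Qed.

(** Both quantities are even in k, so k may be taken positive. The lower bound is limited to |k| <=
    1 because csch decays exponentially; there it makes the layer forms control differences of
    neighbours. *)
Lemma layer_bounds (d k : R) : 0 < d -> k != 0 ->
  [/\ 0 < k * cschR (k * d), k * cschR (k * d) <= k * cothR (k * d),
      k * cothR (k * d) <= d^-1 + `|k| &
      (`|k| <= 1 -> (d * expR d)^-1 <= k * cschR (k * d))].
Proof.
move=> d0 k0.
have -> : k * cothR (k * d) = `|k| * cothR (`|k| * d).
  by case: (ger0P k) => // _; rewrite !mulNr /cothR coshRN sinhRN invrN !mulrN opprK.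
have -> : k * cschR (k * d) = `|k| * cschR (`|k| * d).
  by case: (ger0P k) => // _; rewrite !mulNr /cschR sinhRN invrN mulrN opprK.
have : 0 < `|k| by rewrite normr_gt0.
move: (`|k| : R) => {k0} {}k k0.
have kd0 : 0 < k * d by rewrite mulr_gt0.
have s0 := sinhR_gt0 kd0.
split.
- by rewrite mulr_gt0// invr_gt0.
- rewrite ler_pM2l// /cschR /cothR -[leLHS]mul1r ler_pM2r ?invr_gt0//; exact: coshR_ge1.
- have := cothR_le kd0; rewrite -(ler_pM2l d0) => h.
  rewrite -(ler_pM2l d0) mulrDr mulfV ?gt_eqF//.
  have := cothR_le kd0; lra.
- move=> k1; have de0 : 0 < d * expR d by rewrite mulr_gt0// expR_gt0.
  rewrite /cschR ler_pdivlMr// ler_pdivrMl//.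
  apply: (le_trans (sinhR_le kd0)).
  rewrite (_ : k * d * expR (k * d) = d * expR (k * d) * k); last by ring.
  by rewrite ler_pM2r// ler_pM2l// ler_expR ler_piMl// ltW.
Qed.

(** The form is (c - s)(a^2 + b^2) plus the difference term s (a - b)^2. *)
Lemma layer_form_ge (c s a b : R) : 0 <= s -> s <= c ->
  s * (a - b) ^+ 2 <= layer_form c s a b a b.
Proof.
move=> s0 sc; rewrite -subr_ge0 /layer_form.
have -> : c * (a * a + b * b) - s * (a * b + b * a) - s * (a - b) ^+ 2 =
  (c - s) * (a ^+ 2 + b ^+ 2) by ring.
by rewrite mulr_ge0 ?subr_ge0// addr_ge0 ?sqr_ge0.
Qed.

Lemma layer_form_ge0 (c s a b : R) : 0 <= s -> s <= c -> 0 <= layer_form c s a b a b.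
Proof. by move=> s0 sc; apply: le_trans (layer_form_ge _ _ s0 sc); rewrite mulr_ge0 ?sqr_ge0. Qed.

Lemma layer_form_le (c s a b : R) : 0 <= s -> s <= c ->
  layer_form c s a b a b <= 2 * c * (a ^+ 2 + b ^+ 2).
Proof.
move=> s0 sc; rewrite -subr_ge0 /layer_form.
have -> : 2 * c * (a ^+ 2 + b ^+ 2) - (c * (a * a + b * b) - s * (a * b + b * a)) =
  (c - s) * (a ^+ 2 + b ^+ 2) + s * (a + b) ^+ 2 by ring.
by rewrite addr_ge0// mulr_ge0 ?subr_ge0 ?addr_ge0 ?sqr_ge0.
Qed.

(* From layer_form >= 0 at (t a - a', t b - b'). *)
Lemma layer_form_am_gm (c s t a b a' b' : R) : 0 <= s -> s <= c ->
  2 * t * layer_form c s a' b' a b <=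
  t ^+ 2 * layer_form c s a b a b + layer_form c s a' b' a' b'.
Proof.
move=> s0 sc.
have := layer_form_ge0 (t * a - a') (t * b - b') s0 sc.
rewrite /layer_form -subr_ge0 => h; rewrite -subr_ge0; move: h; rewrite subr_ge0.
suff -> : c * ((t * a - a') * (t * a - a') + (t * b - b') * (t * b - b')) -
  s * ((t * a - a') * (t * b - b') + (t * b - b') * (t * a - a')) =
  t ^+ 2 * (c * (a * a + b * b) - s * (a * b + b * a)) +
  (c * (a' * a' + b' * b') - s * (a' * b' + b' * a')) -
  2 * t * (c * (a' * a + b' * b) - s * (a' * b + b' * a)) by [].
ring.
Qed.

End Layers.

(** * Energy inequalities uniform in k *)

Section Energy.
Variables (R : realType) (n : nat) (k D sigma V : R) (c s U2 : nat -> R).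
Hypotheses (D1 : 1 <= D) (sigma0 : 0 < sigma) (V0 : 0 <= V).
Hypothesis s0 : forall j, (j <= n)%N -> 0 < s j.
Hypothesis sc : forall j, (j <= n)%N -> s j <= c j.
Hypothesis cD : forall j, (j <= n)%N -> c j <= D * (1 + `|k|).
Hypothesis ss : `|k| <= 1 -> forall j, (j <= n)%N -> sigma <= s j.
Hypothesis U0 : forall j, (j <= n)%N -> 0 <= U2 j.
Hypothesis UV : forall j, (j <= n)%N -> U2 j <= V.

(** For c = k coth and s = k csch, weight 1 gives the form of k^2 A - k^2 I and weight U_j^2 the
    form of k B. *)
Definition wform (w : nat -> R) (u v : 'I_n -> R) : R :=
  \sum_(j < n.+1) w j * layer_form (c j) (s j) (bext u j) (bext u j.+1) (bext v j) (bext v j.+1).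
Local Notation Q u := (wform (fun=> 1) u u).
Local Notation sq u := (\sum_i u i ^+ 2).

(* k^2 <A p, p> + w |e|^2 with weight w = 1 + k^2 + k^6: in the rate of
   change k^6 |e|^2 cancels the restoring force k^4 e, while 1 + k^2 controls low
   frequencies. *)
Definition energy (e p : 'I_n -> R) : R :=
  k ^+ 2 * sq p + Q p + (1 + k ^+ 2 + k ^+ 6) * sq e.

(** The first 2 serves |k| > 1, where 1 + k^2 <= 2 k^2; the rest is the Poincare constant, divided
    by the lower bound sigma of the layers and doubled because 1 + k^2 <= 2 for |k| <= 1. *)
Definition coercivity : R := 2 + 2 * (n%:R * 2 ^+ n * 2 / sigma).
(** One summand for each of the four bounds [g1] to [g4] in [energy_rate]. *)
Definition growth : R := 8 * D * V + V + 1 + coercivity.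

Let sq_ge0 (u : 'I_n -> R) : 0 <= sq u.
Proof. by apply: sumr_ge0 => i _; exact: sqr_ge0. Qed.

Let Q_ge0 (u : 'I_n -> R) : 0 <= Q u.
Proof.
apply: sumr_ge0 => -[j jn] _ /=; rewrite mul1r.
by apply: layer_form_ge0; [exact/ltW/s0|exact: sc].
Qed.

Let Q_le (u : 'I_n -> R) : Q u <= 4 * D * (1 + `|k|) * sq u.
Proof.
apply: (@le_trans _ _ (\sum_(j < n.+1) 2 * (D * (1 + `|k|)) * (bext u j ^+ 2 + bext u j.+1 ^+ 2))).
  apply: ler_sum => -[j jn] _ /=; rewrite mul1r.
  apply: (le_trans (layer_form_le _ _ (ltW (s0 jn)) (sc jn))).
  by rewrite ler_wpM2r ?addr_ge0 ?sqr_ge0// ler_wpM2l// cD.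
rewrite -mulr_sumr sum_sqr_bext le_eqVlt; apply/orP; left; apply/eqP; ring.
Qed.

Let coercivity_ge2 : 2 <= coercivity.
Proof. by rewrite /coercivity lerDl !mulr_ge0// invr_ge0 ltW. Qed.

(** For |k| > 1 the term k^2 |p|^2 suffices. For |k| <= 1 it degenerates, and the layer forms take
    over through [bext_poincare]. *)
Let poincare (p : 'I_n -> R) : (1 + k ^+ 2) * sq p <= coercivity * (k ^+ 2 * sq p + Q p).
Proof.
have k2 : `|k| ^+ 2 = k ^+ 2 by rewrite real_normK ?num_real.
have kp : 0 <= k ^+ 2 * sq p by rewrite mulr_ge0 ?sqr_ge0.
have [k1|k1] := lerP `|k| 1.
  have kk : k ^+ 2 <= 1 by rewrite -k2 expr_le1.
  apply: (@le_trans _ _ (2 * sq p)); first by rewrite ler_wpM2r//; lra.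
  apply: (@le_trans _ _ (2 * (n%:R * 2 ^+ n * 2 / sigma) * Q p)); last first.
    have : 2 * (n%:R * 2 ^+ n * 2 / sigma) * Q p <= coercivity * Q p.
      by rewrite ler_wpM2r// /coercivity; lra.
    have : 0 <= coercivity * (k ^+ 2 * sq p) by rewrite mulr_ge0// (le_trans _ coercivity_ge2).
    rewrite mulrDr; lra.
  rewrite -mulrA ler_pM2l//; apply: (le_trans (bext_poincare p)).
  rewrite -!mulrA ler_wpM2l// ler_wpM2l ?exprn_ge0// ler_pM2l//.
  rewrite mulrC ler_pdivlMr// mulrC mulr_sumr; apply: ler_sum => -[j jn] _ /=; rewrite mul1r.
  apply: le_trans (layer_form_ge _ _ (ltW (s0 jn)) (sc jn)).
  by rewrite -[(_ - bext p j) ^+ 2]sqrrN opprB ler_wpM2r ?sqr_ge0//; exact: ss.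
have kk : 1 <= k ^+ 2 by rewrite -k2 exprn_ege1// ltW.
apply: (@le_trans _ _ (2 * (k ^+ 2 * sq p))).
  by rewrite mulrA ler_wpM2r//; lra.
apply: (@le_trans _ _ (coercivity * (k ^+ 2 * sq p))); first by rewrite ler_wpM2r.
by rewrite ler_wpM2l ?lerDl// (le_trans _ coercivity_ge2).
Qed.

Lemma energy_ge (e p : 'I_n -> R) :
  (1 + k ^+ 2) * (sq e + sq p) <= coercivity * energy e p.
Proof.
have h1 := poincare p; rewrite /energy mulrDr mulrDr addrC lerD//.
have k6 : 0 <= k ^+ 6 by rewrite exprn_even_ge0.
have k2 : 0 <= k ^+ 2 by exact: sqr_ge0.
rewrite mulrA ler_wpM2r//.
have : 1 * (1 + k ^+ 2 + k ^+ 6) <= coercivity * (1 + k ^+ 2 + k ^+ 6).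
  by apply: ler_wpM2r; have := coercivity_ge2; lra.
lra.
Qed.

Let abs_le : `|k| <= (1 + k ^+ 2) / 2.
Proof.
have := sqr_ge0 (`|k| - 1).
have -> : (`|k| - 1) ^+ 2 = `|k| ^+ 2 - 2 * `|k| + 1 by ring.
rewrite real_normK ?num_real//; lra.
Qed.

(** The weight k^6 on |e|^2 costs the third power of 1 + k^2; the p-terms contribute D + 6 D, below
    8 D. *)
Lemma energy_le (e p : 'I_n -> R) :
  energy e p <= 8 * D * (1 + k ^+ 2) ^+ 3 * (sq e + sq p).
Proof.
have Qp := Q_le p; have se := sq_ge0 e; have sp := sq_ge0 p.
have k2 : 0 <= k ^+ 2 by exact: sqr_ge0.
set x := k ^+ 2 in k2 *.
have k6 : k ^+ 6 = x ^+ 3 by rewrite /x -exprM.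
have x2 : 0 <= x ^+ 2 by exact: sqr_ge0.
have x3 : 0 <= x ^+ 3 by rewrite exprn_ge0.
have E3 : (1 + x) ^+ 3 = 1 + 3 * x + 3 * x ^+ 2 + x ^+ 3 by ring.
have w : 1 + x + k ^+ 6 <= (1 + x) ^+ 3 by rewrite k6 E3; lra.
have l : 1 + `|k| <= 3 / 2 * (1 + x) ^+ 3 by have := abs_le; rewrite -/x E3; lra.
have y0 : 0 <= (1 + x) ^+ 3 by rewrite E3; lra.
have a1 : x * sq p <= D * (1 + x) ^+ 3 * sq p.
  rewrite ler_wpM2r//; apply: (@le_trans _ _ (1 * (1 + x) ^+ 3)); first by rewrite E3; lra.
  by rewrite ler_wpM2r.
have a2 : Q p <= 6 * D * (1 + x) ^+ 3 * sq p.
  apply: (le_trans Qp); rewrite ler_wpM2r//.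
  have : D * (1 + `|k|) <= D * (3 / 2 * (1 + x) ^+ 3) by rewrite ler_wpM2l// (le_trans _ D1).
  lra.
have a3 : (1 + x + k ^+ 6) * sq e <= D * (1 + x) ^+ 3 * sq e.
  rewrite ler_wpM2r//; apply: (le_trans w).
  by rewrite -[leLHS]mul1r ler_wpM2r.
have D0 : 0 <= D by rewrite (le_trans _ D1).
have z0 : 0 <= D * (1 + x) ^+ 3 * sq p by apply: mulr_ge0 => //; exact: mulr_ge0.
have z1 : 0 <= D * (1 + x) ^+ 3 * sq e by apply: mulr_ge0 => //; exact: mulr_ge0.
rewrite /energy -/x mulrDr; lra.
Qed.

(** The left side is what remains of the rate after the cancellations. In each layer the AM-GM
    inequality with parameter t = k^2 puts k^4 on Q(e), which is then of order |k|^5 |e|^2 for large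
    |k|, below the weight k^6; this balance makes the constant independent of k. *)
Lemma energy_rate (e p : 'I_n -> R) :
  2 * k ^+ 2 * wform U2 p e + 2 * (1 + k ^+ 2) * \sum_i e i * p i <=
  growth * energy e p.
Proof.
have Qe := Q_le e; have se := sq_ge0 e; have sp := sq_ge0 p; have Qp := Q_ge0 p.
have k2 : 0 <= k ^+ 2 by exact: sqr_ge0.
have k6 : 0 <= k ^+ 6 by rewrite exprn_even_ge0.
have D0 : 0 <= D by rewrite (le_trans _ D1).
have h1 : 2 * k ^+ 2 * wform U2 p e <= V * (k ^+ 4 * Q e + Q p).
  rewrite /wform !mulr_sumr -big_split /= mulr_sumr.
  apply: ler_sum => -[j jn] _ /=; rewrite !mul1r mulrCA.
  have := layer_form_am_gm (k ^+ 2) (bext e j) (bext e j.+1) (bext p j) (bext p j.+1) (ltW (s0 jn)) (sc jn).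
  have lf0 a b : 0 <= layer_form (c j) (s j) a b a b.
    by apply: layer_form_ge0; [exact/ltW/s0|exact: sc].
  rewrite -exprM => h; apply: (le_trans (ler_wpM2l (U0 jn) h)).
  apply: ler_wpM2r; last exact: UV.
  by apply: addr_ge0 => //; apply: mulr_ge0 => //; rewrite exprn_even_ge0.
have h2 : 2 * \sum_i e i * p i <= sq e + sq p.
  rewrite mulr_sumr -big_split /=; apply: ler_sum => i _.
  by have := sqr_ge0 (e i - p i); rewrite !expr2; lra.
have h2' : (1 + k ^+ 2) * (2 * \sum_i e i * p i) <= (1 + k ^+ 2) * (sq e + sq p).
  by rewrite ler_wpM2l//; lra.
have h3 : k ^+ 4 * Q e <= 8 * D * ((1 + k ^+ 2 + k ^+ 6) * sq e).
  apply: (@le_trans _ _ (k ^+ 4 * (4 * D * (1 + `|k|) * sq e))).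
    by rewrite ler_wpM2l// exprn_even_ge0.
  (* From |k| <= (1 + k^2) / 2 and 2 k^4 <= k^6 + k^2, the latter being k^2 (k^2 - 1)^2 >= 0. *)
  have kk : k ^+ 4 * (1 + `|k|) <= 2 * (1 + k ^+ 2 + k ^+ 6).
    have k4 : 0 <= k ^+ 4 by rewrite exprn_even_ge0.
    have := ler_wpM2l k4 abs_le.
    have := mulr_ge0 k2 (sqr_ge0 (k ^+ 2 - 1)).
    have -> : k ^+ 2 * (k ^+ 2 - 1) ^+ 2 = k ^+ 6 - 2 * k ^+ 4 + k ^+ 2 by ring.
    have -> : k ^+ 4 * ((1 + k ^+ 2) / 2) = k ^+ 4 / 2 + k ^+ 6 / 2 by field.
    rewrite mulrDr; lra.
  have -> : k ^+ 4 * (4 * D * (1 + `|k|) * sq e) = 4 * D * sq e * (k ^+ 4 * (1 + `|k|)) by ring.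
  have -> : 8 * D * ((1 + k ^+ 2 + k ^+ 6) * sq e) = 4 * D * sq e * (2 * (1 + k ^+ 2 + k ^+ 6)) by ring.
  by rewrite ler_wpM2l// !mulr_ge0.
have h4 := poincare p.
have E0 : 0 <= (1 + k ^+ 2 + k ^+ 6) * sq e by rewrite mulr_ge0//; lra.
have P0 : 0 <= k ^+ 2 * sq p by rewrite mulr_ge0.
set W := (1 + k ^+ 2 + k ^+ 6) * sq e in h3 E0 *.
have h5 : (1 + k ^+ 2) * sq e <= W by rewrite ler_wpM2r//; lra.
have G : energy e p = k ^+ 2 * sq p + Q p + W by [].
have g1 : V * (k ^+ 4 * Q e) <= 8 * D * V * energy e p.
  have : V * (k ^+ 4 * Q e) <= V * (8 * D * W) by rewrite ler_wpM2l.
  have : 8 * D * V * W <= 8 * D * V * energy e p.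
    by rewrite ler_wpM2l ?mulr_ge0// G; lra.
  lra.
have g2 : V * Q p <= V * energy e p by rewrite ler_wpM2l// G; lra.
have g3 : (1 + k ^+ 2) * sq e <= energy e p by rewrite G; lra.
have g4 : (1 + k ^+ 2) * sq p <= coercivity * energy e p.
  apply: (le_trans h4); rewrite ler_wpM2l ?(le_trans _ coercivity_ge2)// G; lra.
have t1 : 2 * k ^+ 2 * wform U2 p e <= V * (k ^+ 4 * Q e) + V * Q p by rewrite -mulrDr.
have t2 : 2 * (1 + k ^+ 2) * (\sum_i e i * p i) <= (1 + k ^+ 2) * sq e + (1 + k ^+ 2) * sq p.
  by rewrite -mulrDr (mulrC 2) -mulrA.
apply: (le_trans (lerD t1 t2)); apply: (le_trans (lerD (lerD g1 g2) (lerD g3 g4))).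
by rewrite le_eqVlt; apply/orP; left; apply/eqP; rewrite /growth; ring.
Qed.

End Energy.

(** * Differentiation rules and Gronwall's lemma *)

Section Calculus.
Variable R : realType.

Lemma is_deriveMf (f g : R -> R) (t df dg : R) :
  is_derive t 1 f df -> is_derive t 1 g dg ->
  is_derive t 1 (fun s => f s * g s) (df * g t + f t * dg).
Proof.
move=> Hf Hg; have := is_deriveM Hf Hg.
by move=> H; apply: (is_derive_eq H); rewrite /GRing.scale /=; ring.
Qed.

Lemma is_deriveDf (f g : R -> R) (t df dg : R) :
  is_derive t 1 f df -> is_derive t 1 g dg ->
  is_derive t 1 (fun s => f s + g s) (df + dg).
Proof. by move=> Hf Hg; exact: is_deriveD Hf Hg. Qed.

Lemma is_deriveZf (f : R -> R) (a t df : R) :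
  is_derive t 1 f df -> is_derive t 1 (fun s => a * f s) (a * df).
Proof. by move=> Hf; exact: is_deriveZ Hf. Qed.

Lemma is_deriveBf (f g : R -> R) (t df dg : R) :
  is_derive t 1 f df -> is_derive t 1 g dg ->
  is_derive t 1 (fun s => f s - g s) (df - dg).
Proof. by move=> Hf Hg; exact: is_deriveB Hf Hg. Qed.

Lemma is_derive_sumf (I : Type) (r : seq I) (f : I -> R -> R) (t : R) (df : I -> R) :
  (forall i, is_derive t 1 (f i) (df i)) ->
  is_derive t 1 (fun s => \sum_(i <- r) f i s) (\sum_(i <- r) df i).
Proof.
move=> H; elim: r => [|i r IH].
  rewrite big_nil (_ : (fun s => _) = cst 0); first exact: is_derive_cst.
  by apply/funext => s; rewrite big_nil.
rewrite big_cons (_ : (fun s => _) = (fun s => f i s + \sum_(j <- r) f j s)).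
  exact: is_deriveDf.
by apply/funext => s; rewrite big_cons.
Qed.

(** The function exp(-K s) g(s) has nonpositive derivative, so by the mean value theorem it is at
    most its value at 0. *)
Lemma gronwall (g dg : R -> R) (K t : R) :
  (forall s : R, is_derive s 1 g (dg s)) -> (forall s, dg s <= K * g s) -> 0 <= t ->
  g t <= expR (K * t) * g 0.
Proof.
move=> gd gK t0.
pose f s := expR (- K * s) * g s.
have fd (s : R) : is_derive s 1 f (expR (- K * s) * (dg s - K * g s)).
  have e1 : is_derive s 1 (fun u => - K * u) (- K * 1) by apply: is_deriveZf; exact: is_derive_id.
  have e2 : is_derive s 1 (fun u => expR (- K * u)) (- K * expR (- K * s)).
    have := @is_derive1_comp R expR (fun u => - K * u) s _ _ (is_derive_expR _) e1.
    by move=> H; apply: (is_derive_eq H); rewrite /GRing.scale /=; ring.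
  by apply: (is_derive_eq (is_deriveMf e2 (gd s))); ring.
have cf : {within `[0, t]%classic, continuous f}.
  apply: continuous_subspaceT => s; apply: differentiable_continuous.
  by apply/derivable1_diffP; exact: (@ex_derive _ _ _ _ _ _ _ (fd s)).
have [c _ fE] := MVT_segment t0 (fun s _ => fd s) cf.
have : f t <= f 0.
  rewrite -subr_le0 fE subr0 mulr_le0_ge0//.
  by rewrite mulr_ge0_le0 ?expR_ge0// subr_le0.
rewrite /f mulr0 expR0 mul1r mulNr expRN => h.
by rewrite -ler_pdivrMl ?expR_gt0.
Qed.

End Calculus.

(** * Real and imaginary parts of the equations *)

Section Rows.
Variables (R : realType) (n : nat).
Local Open Scope complex_scope.
Local Notation C := R[i].
Local Notation Re := (@complex.Re R).
Local Notation Im := (@complex.Im R).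

Lemma shifted_row (B : 'M[R]_n) (a b : R) (i : 'I_n) (w : 'I_n -> R) :
  \sum_j (a *: B - b%:M) i j * w j = a * (\sum_j B i j * w j) - b * w i.
Proof.
rewrite mulr_sumr [b * w i](_ : _ = \sum_j (b *+ (i == j)) * w j).
  by rewrite -sumrB; apply: eq_bigr => j _; rewrite !mxE; ring.
rewrite (bigD1 i)//= eqxx mulr1n big1 ?addr0// => j ji.
by rewrite eq_sym (negbTE ji) mulr0n mul0r.
Qed.

(** Multiplication by -2i exchanges the real and imaginary parts of p with opposite signs; this is
    the skewness of the C-term. *)
Lemma toC_row (A B D : 'M[R]_n) (y e p : 'cV[C]_n) (i : 'I_n) :
  toC A *m y = toC B *m e + (- ((2%:R)%:C * 'i) *: toC D) *m p ->
  \sum_j A i j * Re (y j 0) =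
    \sum_j B i j * Re (e j 0) + 2 * (\sum_j D i j * Im (p j 0)) /\
  \sum_j A i j * Im (y j 0) =
    \sum_j B i j * Im (e j 0) - 2 * (\sum_j D i j * Re (p j 0)).
Proof.
move=> /matrixP/(_ i 0); rewrite !mxE => E.
split.
- move/(congr1 Re): E; rewrite ReD !Re_sum mulr_sumr => E.
  have -> : \sum_j A i j * Re (y j 0) = \sum_j Re (toC A i j * y j 0).
    by apply: eq_bigr => j _; rewrite mxE ReM /= mul0r subr0.
  rewrite E; congr (_ + _); apply: eq_bigr => j _; rewrite !mxE.
    by rewrite ReM /= mul0r subr0.
  by case: (p j 0) => a b /=; ring.
- move/(congr1 Im): E; rewrite ImD !Im_sum mulr_sumr -sumrN => E.
  have -> : \sum_j A i j * Im (y j 0) = \sum_j Im (toC A i j * y j 0).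
    by apply: eq_bigr => j _; rewrite mxE ImM /= mul0r addr0.
  rewrite E; congr (_ + _); apply: eq_bigr => j _; rewrite !mxE.
    by rewrite ImM /= mul0r addr0.
  by case: (p j 0) => a b /=; ring.
Qed.
End Rows.

(** * The matrices of the system as layer forms *)

Section System.
Variables (R : realType) (n : nat) (h U : nat -> R) (k : R).
Hypothesis k0 : k != 0.
Hypothesis hd : forall j, (j <= n)%N -> 0 < dh h j.
Local Open Scope complex_scope.
Local Notation C := R[i].
Local Notation Re := (@complex.Re R).
Local Notation Im := (@complex.Im R).
Local Notation A := (matA n h k).
Local Notation B := (matB n h U k).
Local Notation CC := (matC n h U k).
Local Notation M := (matM n h U k).

Let c j := k * cothR (k * dh h j).
Let s j := k * cschR (k * dh h j).
Let wf := @wform R n c s.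

Lemma matA_form (u v : 'I_n -> R) :
  k ^+ 2 * (\sum_i u i * \sum_j A i j * v j) =
  k ^+ 2 * (\sum_i u i * v i) + wf (fun=> 1) u v.
Proof.
have -> : A = tridiag n
    (fun i => 1 + (cothR (k * dh h i) / k + cothR (k * dh h i.+1) / k))
    (fun i => - (cschR (k * dh h i.+1) / k)).
  by apply/matrixP => i j; rewrite !mxE mulrDl mulNr.
rewrite (tridiag_form 1 (fun j => cothR (k * dh h j) / k) (fun j => cschR (k * dh h j) / k)).
rewrite mul1r mulrDr; congr (_ + _); rewrite mulr_sumr; apply: eq_bigr => j _.
rewrite /layer_form /c /s; field; exact: k0.
Qed.

Lemma matB_form (u v : 'I_n -> R) :
  k * (\sum_i u i * \sum_j B i j * v j) = wf (fun j => U j ^+ 2) u v.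
Proof.
have -> : B = tridiag n
    (fun i => 0 + (U i ^+ 2 * cothR (k * dh h i) + U i.+1 ^+ 2 * cothR (k * dh h i.+1)))
    (fun i => - (U i.+1 ^+ 2 * cschR (k * dh h i.+1))).
  by apply/matrixP => i j; rewrite !mxE add0r.
rewrite (tridiag_form 0 (fun j => U j ^+ 2 * cothR (k * dh h j)) (fun j => U j ^+ 2 * cschR (k * dh h j))).
rewrite mul0r add0r mulr_sumr; apply: eq_bigr => j _.
rewrite /layer_form /c /s; ring.
Qed.

Lemma matC_sym (u v : 'I_n -> R) :
  \sum_i u i * (\sum_j CC i j * v j) = \sum_i v i * (\sum_j CC i j * u j).
Proof.
have -> : CC = tridiag n
    (fun i => 0 + (U i * cothR (k * dh h i) + U i.+1 * cothR (k * dh h i.+1)))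
    (fun i => - (U i.+1 * cschR (k * dh h i.+1))).
  by apply/matrixP => i j; rewrite !mxE add0r.
rewrite !(tridiag_form 0 (fun j => U j * cothR (k * dh h j)) (fun j => U j * cschR (k * dh h j))).
rewrite !mul0r; congr (_ + _); apply: eq_bigr => j _.
rewrite /layer_form; ring.
Qed.

(** The layer forms are nonnegative, so k^2 <v, A v> >= k^2 |v|^2 and a null vector of A is 0. *)
Lemma matA_det : \det A != 0.
Proof.
apply/det0P => -[v v0 vA].
have E : \sum_i v 0 i * \sum_j A i j * v 0 j = 0.
  under eq_bigr do rewrite mulr_sumr.
  rewrite exchange_big /=; apply: big1 => j _.
  under eq_bigr do rewrite mulrA.
  by rewrite -mulr_suml; have := congr1 (fun w : 'rV_n => w 0 j) vA; rewrite !mxE => ->; rewrite mul0r.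
have := matA_form (fun i => v 0 i) (fun i => v 0 i); rewrite E mulr0.
have w0 : 0 <= wf (fun=> 1) (fun i => v 0 i) (fun i => v 0 i).
  apply: sumr_ge0 => -[j jn] _ /=; rewrite mul1r.
  by have [s0 sc _ _] := layer_bounds (hd jn) k0; apply: layer_form_ge0 => //; exact: ltW.
have v2 : 0 <= \sum_i v 0 i * v 0 i by apply: sumr_ge0 => i _; rewrite -expr2 sqr_ge0.
have k2 : 0 < k ^+ 2 by rewrite exprn_even_gt0.
move=> H.
have /eqP : \sum_i v 0 i * v 0 i = 0.
  apply/eqP; rewrite eq_le v2 andbT -(ler_pM2l k2) mulr0; lra.
rewrite psumr_eq0 => [/allP vz|i _]; last by rewrite -expr2 sqr_ge0.
move/eqP: v0; apply; apply/rowP => i; rewrite mxE; apply/eqP.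
by have := vz i (mem_index_enum _); rewrite /= -expr2 sqrf_eq0.
Qed.

Lemma matM1_unit : matM1 n h k \in unitmx.
Proof.
rewrite unitmxE /matM1 det_ublock det1 mul1r /toC det_map_mx unitfE.
by rewrite fmorph_eq0 matA_det.
Qed.

Lemma matM_upper (x : 'cV[C]_(n + n)) : usubmx (M *m x) = dsubmx x.
Proof.
have u1 := matM1_unit.
have : matM1 n h k *m col_mx (usubmx (M *m x)) (dsubmx (M *m x)) =
    matM2 n h U k *m col_mx (usubmx x) (dsubmx x).
  by rewrite !vsubmxK mulmxA /matM mulKVmx.
rewrite /matM1 /matM2 !mul_block_col.
by rewrite !mul1mx !mul0mx addr0 !add0r => /eq_col_mx[].
Qed.

(** Read off from M1 (M x) = M2 x: the inverse of A never appears, as the energy only involves A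
    p'. *)
Lemma matM_lower (x : 'cV[C]_(n + n)) i :
  let yd := dsubmx (M *m x) in let xu := usubmx x in let xd := dsubmx x in
  \sum_j A i j * Re (yd j 0) =
    k * (\sum_j B i j * Re (xu j 0)) - k ^+ 4 * Re (xu i 0) +
    2 * (\sum_j CC i j * Im (xd j 0)) /\
  \sum_j A i j * Im (yd j 0) =
    k * (\sum_j B i j * Im (xu j 0)) - k ^+ 4 * Im (xu i 0) -
    2 * (\sum_j CC i j * Re (xd j 0)).
Proof.
move=> yd xu xd; have u1 := matM1_unit.
have : matM1 n h k *m col_mx (usubmx (M *m x)) (dsubmx (M *m x)) =
    matM2 n h U k *m col_mx (usubmx x) (dsubmx x).
  by rewrite !vsubmxK mulmxA /matM mulKVmx.
rewrite /matM1 /matM2 !mul_block_col.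
rewrite !mul1mx !mul0mx addr0 !add0r => /eq_col_mx[_ E].
have [E1 E2] := toC_row i E.
by rewrite E1 E2 !shifted_row.
Qed.

End System.

(** * The energy along a trajectory *)

Section Energy_estimate.
Variables (R : realType) (n : nat) (h U : nat -> R) (k : R).
Variables (D sigma V : R).
Hypothesis k0 : k != 0.
Hypothesis hd : forall j, (j <= n)%N -> 0 < dh h j.
Hypotheses (D1 : 1 <= D) (sigma0 : 0 < sigma) (V0 : 0 <= V).
Hypothesis dD : forall j, (j <= n)%N -> (dh h j)^-1 <= D.
Hypothesis dsigma : forall j, (j <= n)%N -> sigma <= (dh h j * expR (dh h j))^-1.
Hypothesis UV : forall j, (j <= n)%N -> U j ^+ 2 <= V.
Local Open Scope complex_scope.
Local Notation C := R[i].
Local Notation Re := (@complex.Re R).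
Local Notation Im := (@complex.Im R).
Local Notation M := (matM n h U k).

Let c j := k * cothR (k * dh h j).
Let s j := k * cschR (k * dh h j).
Let w := 1 + k ^+ 2 + k ^+ 6.
Local Notation En := (@energy R n k c s).
Local Notation wf := (@wform R n c s).

Let s0 j : (j <= n)%N -> 0 < s j.
Proof. by move=> jn; have [] := layer_bounds (hd jn) k0. Qed.
Let sc j : (j <= n)%N -> s j <= c j.
Proof. by move=> jn; have [] := layer_bounds (hd jn) k0. Qed.
Let cD j : (j <= n)%N -> c j <= D * (1 + `|k|).
Proof.
move=> jn; have [_ _ cj _] := layer_bounds (hd jn) k0; apply: (le_trans cj).
rewrite mulrDr mulr1 lerD ?dD// ler_peMl//.
Qed.
Let ss : `|k| <= 1 -> forall j, (j <= n)%N -> sigma <= s j.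
Proof.
move=> k1 j jn; have [_ _ _ sj] := layer_bounds (hd jn) k0.
by apply: (le_trans (dsigma jn)); exact: sj.
Qed.

Lemma is_derive_bext (p : R -> 'I_n -> R) (dp : 'I_n -> R) (t : R) j :
  (forall i, is_derive t 1 (fun u => p u i) (dp i)) ->
  is_derive t 1 (fun u => bext (p u) j) (bext dp j).
Proof.
move=> H; case: j => [|j]; first exact: is_derive_cst.
rewrite /bext; case: insubP => [i _ _|_]; first exact: H.
exact: is_derive_cst.
Qed.

Lemma is_derive_energy (e p : R -> 'I_n -> R) (de dp : 'I_n -> R) (t : R) :
  (forall i, is_derive t 1 (fun u => e u i) (de i)) ->
  (forall i, is_derive t 1 (fun u => p u i) (dp i)) ->
  is_derive t 1 (fun u => En (e u) (p u))
    (2 * (k ^+ 2 * (\sum_i p t i * dp i) + wf (fun=> 1) (p t) dp + w * \sum_i e t i * de i)).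
Proof.
move=> He Hp.
have sqd (f : R -> 'I_n -> R) (df : 'I_n -> R) :
    (forall i, is_derive t 1 (fun u => f u i) (df i)) ->
    is_derive t 1 (fun u => \sum_i f u i ^+ 2) (\sum_i (df i * f t i + f t i * df i)).
  by move=> Hf; apply: is_derive_sumf => i; exact: (is_deriveMf (Hf i) (Hf i)).
have wd : is_derive t 1 (fun u => wf (fun=> 1) (p u) (p u))
   (\sum_(j < n.+1) 1 * (c j * ((bext dp j * bext (p t) j + bext (p t) j * bext dp j) +
      (bext dp j.+1 * bext (p t) j.+1 + bext (p t) j.+1 * bext dp j.+1)) -
     s j * ((bext dp j * bext (p t) j.+1 + bext (p t) j * bext dp j.+1) +
      (bext dp j.+1 * bext (p t) j + bext (p t) j.+1 * bext dp j)))).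
  apply: is_derive_sumf => j; apply: is_deriveZf.
  have b1 := is_derive_bext j Hp; have b2 := is_derive_bext j.+1 Hp.
  apply: is_deriveBf; apply: is_deriveZf; apply: is_deriveDf; exact: is_deriveMf.
have H := is_deriveDf (is_deriveDf (is_deriveZf (k ^+ 2) (sqd _ _ Hp)) wd) (is_deriveZf w (sqd _ _ He)).
apply: (is_derive_eq H).
rewrite mulrDr mulrDr; congr (_ + _ + _).
- by rewrite !mulr_sumr; apply: eq_bigr => i _; ring.
- by rewrite /wform mulr_sumr; apply: eq_bigr => j _; rewrite /layer_form; ring.
- by rewrite !mulr_sumr; apply: eq_bigr => i _; ring.
Qed.

Variable v : 'cV[C]_(n + n).
Let x t := mxexp (t%:C *: M) *m v.

Let dx (t : R) i : cderive (fun u => x u i 0) t ((M *m x t) i 0).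
Proof.
have E j := cderive_mxexp M t i j.
split.
- have -> : (fun u => Re (x u i 0)) = (fun u => \sum_j (Re (v j 0) * Re (mxexp (u%:C *: M) i j) - Im (v j 0) * Im (mxexp (u%:C *: M) i j))).
    apply/funext => u; rewrite mxE Re_sum; apply: eq_bigr => j _; rewrite ReM; ring.
  have -> : Re ((M *m x t) i 0) = \sum_j (Re (v j 0) * Re ((M *m mxexp (t%:C *: M)) i j) - Im (v j 0) * Im ((M *m mxexp (t%:C *: M)) i j)).
    rewrite /x mulmxA [in LHS]mxE Re_sum; apply: eq_bigr => j _; rewrite ReM; ring.
  apply: is_derive_sumf => j; apply: is_deriveBf; apply: is_deriveZf; [exact: (E j).1|exact: (E j).2].
- have -> : (fun u => Im (x u i 0)) = (fun u => \sum_j (Re (v j 0) * Im (mxexp (u%:C *: M) i j) + Im (v j 0) * Re (mxexp (u%:C *: M) i j))).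
    apply/funext => u; rewrite mxE Im_sum; apply: eq_bigr => j _; rewrite ImM; ring.
  have -> : Im ((M *m x t) i 0) = \sum_j (Re (v j 0) * Im ((M *m mxexp (t%:C *: M)) i j) + Im (v j 0) * Re ((M *m mxexp (t%:C *: M)) i j)).
    rewrite /x mulmxA [in LHS]mxE Im_sum; apply: eq_bigr => j _; rewrite ImM; ring.
  apply: is_derive_sumf => j; apply: is_deriveDf; apply: is_deriveZf; [exact: (E j).2|exact: (E j).1].
Qed.

Let er t (i : 'I_n) := Re (usubmx (x t) i 0).
Let ei t (i : 'I_n) := Im (usubmx (x t) i 0).
Let pr t (i : 'I_n) := Re (dsubmx (x t) i 0).
Let pim t (i : 'I_n) := Im (dsubmx (x t) i 0).
Let ar t (i : 'I_n) := Re (dsubmx (M *m x t) i 0).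
Let ai t (i : 'I_n) := Im (dsubmx (M *m x t) i 0).

Let uE (z : 'cV[C]_(n + n)) i : usubmx z i 0 = z (lshift n i) 0.
Proof. by rewrite mxE. Qed.
Let dE (z : 'cV[C]_(n + n)) i : dsubmx z i 0 = z (rshift n i) 0.
Proof. by rewrite mxE. Qed.

Let der (t : R) i : is_derive t 1 (fun u => er u i) (pr t i).
Proof.
rewrite /pr -(matM_upper U k0 hd) uE.
have -> : (fun u => er u i) = (fun u => Re (x u (lshift n i) 0)).
  by apply/funext => u; rewrite /er uE.
exact: (dx t (lshift n i)).1.
Qed.
Let dei (t : R) i : is_derive t 1 (fun u => ei u i) (pim t i).
Proof.
rewrite /pim -(matM_upper U k0 hd) uE.
have -> : (fun u => ei u i) = (fun u => Im (x u (lshift n i) 0)).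
  by apply/funext => u; rewrite /ei uE.
exact: (dx t (lshift n i)).2.
Qed.
Let dpr (t : R) i : is_derive t 1 (fun u => pr u i) (ar t i).
Proof.
rewrite /ar dE.
have -> : (fun u => pr u i) = (fun u => Re (x u (rshift n i) 0)).
  by apply/funext => u; rewrite /pr dE.
exact: (dx t (rshift n i)).1.
Qed.
Let dpi (t : R) i : is_derive t 1 (fun u => pim u i) (ai t i).
Proof.
rewrite /ai dE.
have -> : (fun u => pim u i) = (fun u => Im (x u (rshift n i) 0)).
  by apply/funext => u; rewrite /pim dE.
exact: (dx t (rshift n i)).2.
Qed.

(** The C-term couples real and imaginary parts; it cancels only in the sum of their energies. *)
Let g t := En (er t) (pr t) + En (ei t) (pim t).
Local Notation K := (growth n D sigma V).

Let g_le (t : R) : 0 <= t -> g t <= expR (K * t) * g 0.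
Proof.
move=> t0.
apply: (gronwall (fun u => is_deriveDf (is_derive_energy (der u) (dpr u)) (is_derive_energy (dei u) (dpi u)))) => // u.
(* Reassembles k^2 <p, A p'>, into which the equation for A p' can be substituted. *)
rewrite -!(matA_form h k0).
have lowr i := (matM_lower U k0 hd (x u) i).1.
have lowi i := (matM_lower U k0 hd (x u) i).2.
have -> : \sum_i pr u i * (\sum_j matA n h k i j * ar u j) =
   k * (\sum_i pr u i * \sum_j matB n h U k i j * er u j) - k ^+ 4 * (\sum_i pr u i * er u i)
   + 2 * (\sum_i pr u i * \sum_j matC n h U k i j * pim u j).
  rewrite !mulr_sumr -sumrB -big_split /=; apply: eq_bigr => i _.
  rewrite lowr; ring.
have -> : \sum_i pim u i * (\sum_j matA n h k i j * ai u j) =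
   k * (\sum_i pim u i * \sum_j matB n h U k i j * ei u j) - k ^+ 4 * (\sum_i pim u i * ei u i)
   - 2 * (\sum_i pim u i * \sum_j matC n h U k i j * pr u j).
  rewrite !mulr_sumr -!sumrB /=; apply: eq_bigr => i _.
  rewrite lowi; ring.
(* By symmetry of C the contributions of C to the two energies become opposite. *)
rewrite (matC_sym h U k (pr u) (pim u)) !matB_form.
have -> : \sum_i pr u i * er u i = \sum_i er u i * pr u i by apply: eq_bigr => i _; rewrite mulrC.
have -> : \sum_i pim u i * ei u i = \sum_i ei u i * pim u i by apply: eq_bigr => i _; rewrite mulrC.
have r1 := energy_rate D1 sigma0 V0 s0 sc cD ss (fun j _ => sqr_ge0 (U j)) UV (er u) (pr u).
have r2 := energy_rate D1 sigma0 V0 s0 sc cD ss (fun j _ => sqr_ge0 (U j)) UV (ei u) (pim u).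
rewrite [leRHS]mulrDr; apply: le_trans (lerD r1 r2).
rewrite -[fun j : nat => k * cothR (k * dh h j)]/c -[fun j : nat => k * cschR (k * dh h j)]/s.
by rewrite le_eqVlt; apply/orP; left; apply/eqP; rewrite /w; ring.
Qed.

Lemma mxexp_matM_le (t : R) : 0 <= t ->
  \sum_i cabs2 (x t i 0) <=
  (coercivity n sigma * expR (K * t) * (8 * D)) * (1 + k ^+ 2) ^+ 2 * \sum_i cabs2 (v i 0).
Proof.
move=> t0.
have sE u : \sum_i cabs2 (x u i 0) =
    (\sum_i er u i ^+ 2 + \sum_i pr u i ^+ 2) + (\sum_i ei u i ^+ 2 + \sum_i pim u i ^+ 2).
  rewrite big_split_ord /= addrACA -!big_split /=.
  by apply: eq_bigr => i _; rewrite /er /ei /pr /pim !uE !dE.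
have k2 : 0 < 1 + k ^+ 2 by have := sqr_ge0 k; lra.
have c0 : 0 <= coercivity n sigma.
  by rewrite /coercivity addr_ge0// !mulr_ge0// invr_ge0 ltW.
have x0 : x 0 = v by rewrite /x mxexp0 mul1mx.
have sv := sE 0; rewrite x0 in sv.
(* Multiplied by 1 + k^2, the left side is the lower bound of [energy_ge] and the right side carries
   the third power of [energy_le]. *)
rewrite [leLHS](sE t) [X in _ <= _ * X]sv -(ler_pM2l k2) [leLHS]mulrDr.
have h1 := energy_ge sigma0 s0 sc ss (er t) (pr t).
have h2 := energy_ge sigma0 s0 sc ss (ei t) (pim t).
apply: (le_trans (lerD h1 h2)); rewrite -mulrDr.
apply: (le_trans (ler_wpM2l c0 (g_le t0))).
have l1 := energy_le D1 s0 sc cD (er 0) (pr 0).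
have l2 := energy_le D1 s0 sc cD (ei 0) (pim 0).
have e0 : 0 <= coercivity n sigma * expR (K * t) by rewrite mulr_ge0// expR_ge0.
rewrite [leLHS]mulrA; apply: (le_trans (ler_wpM2l e0 (lerD l1 l2))).
by rewrite le_eqVlt; apply/orP; left; apply/eqP; ring.
Qed.

End Energy_estimate.

(** * The estimate *)

Local Open Scope complex_scope.

(** Sums over the layers stand in for maxima, which gives [D], [V] and sigma = [S^-1] in terms of n,
    h and U alone; as the growth rate is nonnegative, t may be replaced by T. *)
Lemma mxexp_matM_bound (R : realType) (n : nat) (h U : nat -> R) (T : R) :
  (forall j : nat, (j <= n)%N -> h j < h j.+1) ->
  exists2 K : R, 0 <= K &
  forall k t : R, k != 0 -> 0 <= t <= T -> forall v : 'cV[R[i]]_(n + n),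
    \sum_i cabs2 ((mxexp (t%:C *: matM n h U k) *m v) i 0) <=
    K * (1 + k ^+ 2) ^+ 2 * \sum_i cabs2 (v i 0).
Proof.
move=> hlt.
have hd j : (j <= n)%N -> 0 < dh h j by move=> jn; rewrite /dh subr_gt0 hlt.
have le_sum (f : nat -> R) : (forall j, (j <= n)%N -> 0 <= f j) ->
    forall j, (j <= n)%N -> f j <= \sum_(i < n.+1) f i.
  move=> f0 j jn; rewrite (bigD1 (Ordinal (jn : (j < n.+1)%N)))//= lerDl.
  by apply: sumr_ge0 => -[i iN] _; exact: f0.
have sum_ge0 (f : nat -> R) : (forall j, (j <= n)%N -> 0 <= f j) -> 0 <= \sum_(i < n.+1) f i.
  by move=> f0; apply: sumr_ge0 => -[i iN] _; exact: f0.
pose D := 1 + \sum_(i < n.+1) (dh h i)^-1.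
pose S := \sum_(i < n.+1) dh h i * expR (dh h i).
pose V := \sum_(i < n.+1) U i ^+ 2.
have dV0 j : (j <= n)%N -> 0 <= (dh h j)^-1 by move=> jn; rewrite invr_ge0 ltW// hd.
have de0 j : (j <= n)%N -> 0 < dh h j * expR (dh h j) by move=> jn; rewrite mulr_gt0 ?hd ?expR_gt0.
have D1 : 1 <= D by rewrite lerDl; exact: (sum_ge0 (fun j => (dh h j)^-1)).
have V0 : 0 <= V by apply: (sum_ge0 (fun j => U j ^+ 2)) => j _; exact: sqr_ge0.
have S0 : 0 < S.
  apply: lt_le_trans (de0 0%N (leq0n _)) _.
  by apply: (le_sum (fun j => dh h j * expR (dh h j))) => // j jn; exact/ltW/de0.
have sigma0 : 0 < S^-1 by rewrite invr_gt0.
have dD j : (j <= n)%N -> (dh h j)^-1 <= D.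
  move=> jn; apply: (@le_trans _ _ (\sum_(i < n.+1) (dh h i)^-1)); last by rewrite lerDr.
  exact: (le_sum (fun j => (dh h j)^-1)).
have dsigma j : (j <= n)%N -> S^-1 <= (dh h j * expR (dh h j))^-1.
  move=> jn; rewrite lef_pV2 ?posrE ?de0//.
  by apply: (le_sum (fun j => dh h j * expR (dh h j))) => // i iN; exact/ltW/de0.
have UV j : (j <= n)%N -> U j ^+ 2 <= V.
  by apply: (le_sum (fun j => U j ^+ 2)) => i _; exact: sqr_ge0.
have c0 : 0 <= coercivity n S^-1.
  by rewrite /coercivity addr_ge0// !mulr_ge0// invr_ge0 ltW.
have D0 : 0 <= D by rewrite (le_trans _ D1).
clearbody D S V.
have DV0 : 0 <= D * V by exact: mulr_ge0.
have K0 : 0 <= growth n D S^-1 V by move: c0 V0 DV0; rewrite /growth; lra.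
exists (coercivity n S^-1 * expR (growth n D S^-1 V * T) * (8 * D)).
  by apply: mulr_ge0; apply: mulr_ge0 => //; exact: expR_ge0.
move=> k t k0 /andP[t0 tT] v.
apply: (le_trans (mxexp_matM_le k0 hd D1 sigma0 V0 dD dsigma UV v t0)).
rewrite ler_wpM2r ?sumr_ge0// => [i _|]; first exact: cabs2_ge0.
rewrite ler_wpM2r ?sqr_ge0// ler_wpM2r ?mulr_ge0// ler_wpM2l//.
by rewrite ler_expR ler_wpM2l.
Qed.

Theorem theorem3p4 (R : realType) (n : nat) (h U : nat -> R) :
  (1 <= n)%N ->
  (forall j : nat, (j <= n)%N -> h j < h j.+1) ->
  forall T : R, 0 < T ->
  exists Cst : R,
  forall s : R, 2 <= s ->
  forall (eta0 eta1 eta0h eta1h : 'I_n -> R -> R[i])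
         (eta pi_ etah pih : R -> 'I_n -> R -> R[i]),
    (forall i, inHs s (eta0 i) (eta0h i)) ->
    (forall i, inHs s (eta1 i) (eta1h i)) ->
    (forall t, 0 <= t -> forall i,
        is_fourier (eta t i) (etah t i) /\ is_fourier (pi_ t i) (pih t i)) ->
    (forall t, 0 <= t -> forall k : R, k != 0 ->
       let sol := mxexp (t%:C *: matM n h U k)
                    *m col_mx (\col_j eta0h j k) (\col_j eta1h j k) in
       forall i, etah t i k = sol (lshift n i) 0 /\ pih t i k = sol (rshift n i) 0) ->
    forall t, 0 <= t <= T ->
      (\sum_(i < n) (L2norm2 (eta t i) + L2norm2 (pi_ t i))
        <= (Cst ^+ 2)%:E * \sum_(i < n) (Hs_norm2 s (eta0h i) + Hs_norm2 s (eta1h i)))%E.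
Proof.
move=> _ hlt T T0.
have [K K0 HK] := @mxexp_matM_bound R n h U T hlt.
have cF0 := fejer_mass_gt0 R.
have pi0 : 0 < pi :> R by exact: pi_gt0.
pose c := 2 / fejer_mass R.
have c0 : 0 <= c by rewrite divr_ge0// ltW.
(* The factor c comes from the transfer to x-space, K from the estimate on the Fourier side, and 2
   pi undoes the normalisation of [Hs_norm2]. *)
exists (Num.sqrt (c * K * (2 * pi))).
move=> s s2 eta0 eta1 eta0h eta1h eta pi_ etah pih H0 H1 Hf Hsol t tT.
have t0 : 0 <= t by case/andP: tT.
have C0 : 0 <= c * K * (2 * pi).
  by apply: mulr_ge0; [exact: mulr_ge0|exact/ltW/mulr_gt0].
rewrite sqr_sqrtr//.
pose mu := @lebesgue_measure R.
have m0 i := measurable_cabs2 (H0 i).1.2.1.1.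
have m1 i := measurable_cabs2 (H1 i).1.2.1.1.
have me i := measurable_cabs2 (Hf t t0 i).1.2.1.1.
have mp i := measurable_cabs2 (Hf t t0 i).2.2.1.1.
have mw : measurable_fun setT (fun k : R => powR (1 + k ^+ 2) s).
  have mq : measurable_fun setT (fun k : R => 1 + k ^+ 2).
    by apply: measurable_funD => //; exact: measurable_funX.
  exact: (measurableT_comp (measurable_powR s) mq).
have w0 (k : R) : 0 <= powR (1 + k ^+ 2) s by exact: powR_ge0.
pose E k := \sum_(i < n) (cabs2 (etah t i k) + cabs2 (pih t i k)).
pose I0 k := \sum_(i < n) (cabs2 (eta0h i k) + cabs2 (eta1h i k)).
have E0 k : 0 <= E k by apply: sumr_ge0 => i _; rewrite addr_ge0 ?cabs2_ge0.
have I00 k : 0 <= I0 k by apply: sumr_ge0 => i _; rewrite addr_ge0 ?cabs2_ge0.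
have mE : measurable_fun setT E.
  by apply: measurable_sum => i; exact: measurable_funD.
have mI : measurable_fun setT I0.
  by apply: measurable_sum => i; exact: measurable_funD.
have key k : k != 0 -> E k <= K * powR (1 + k ^+ 2) s * I0 k.
  move=> kN0.
  pose v : 'cV[R[i]]_(n + n) := col_mx (\col_j eta0h j k) (\col_j eta1h j k).
  have -> : E k = \sum_i cabs2 ((mxexp (t%:C *: matM n h U k) *m v) i 0).
    rewrite big_split_ord /= -big_split /=; apply: eq_bigr => i _.
    by have [-> ->] := Hsol t t0 k kN0 i.
  have -> : I0 k = \sum_i cabs2 (v i 0).
    rewrite big_split_ord /= -big_split /=; apply: eq_bigr => i _.
    by rewrite /v col_mxEu col_mxEd !mxE.
  apply: (le_trans (HK k t kN0 tT v)).
  rewrite ler_wpM2r//; first by apply: sumr_ge0 => i _; exact: cabs2_ge0.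
  (* Here s >= 2 enters: the base 1 + k^2 is at least 1, so its square is at most its s-th power. *)
  rewrite ler_wpM2l// -powR_mulrn ?addr_ge0 ?sqr_ge0//.
  by rewrite ler_powR// lerDl sqr_ge0.
have L : (\sum_(i < n) (L2norm2 (eta t i) + L2norm2 (pi_ t i)) <= c%:E * \int[mu]_k (E k)%:E)%E.
  have -> : (\int[mu]_k (E k)%:E = \sum_(i < n) (L2norm2 (etah t i) + L2norm2 (pih t i)))%E.
    under eq_integral do rewrite /E -sumEFin.
    rewrite ge0_integral_sum//=; first last.
    - by move=> i k _; rewrite lee_fin addr_ge0 ?cabs2_ge0.
    - by move=> i; apply: measurable_fun_EFin; exact: (measurable_funD (me i) (mp i)).
    apply: eq_bigr => i _; under eq_integral do rewrite EFinD.
    rewrite ge0_integralD//=.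
    - by move=> k _; rewrite lee_fin cabs2_ge0.
    - by apply: measurable_fun_EFin; exact: me.
    - by move=> k _; rewrite lee_fin cabs2_ge0.
    - by apply: measurable_fun_EFin; exact: mp.
  rewrite ge0_sume_distrr; last first.
    by move=> i _; apply: adde_ge0; apply: integral_ge0 => k _; rewrite lee_fin cabs2_ge0.
  apply: lee_sum => i _; rewrite ge0_muleDr; try by apply: integral_ge0 => k _; rewrite lee_fin cabs2_ge0.
  by apply: leeD; apply: L2norm2_le_fourier; [exact: (Hf t t0 i).1|exact: (Hf t t0 i).2].
apply: (le_trans L).
have Rr : (\sum_(i < n) (Hs_norm2 s (eta0h i) + Hs_norm2 s (eta1h i)) =
    (2 * pi)^-1%:E * \int[mu]_k (powR (1 + k ^+ 2) s * I0 k)%:E)%E.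
  have p2 : (0 <= (2 * pi)^-1 :> R) by rewrite invr_ge0 mulr_ge0// ltW.
  have mwf (f : R -> R[i]) : measurable_fun setT (fun k => cabs2 (f k)) ->
      measurable_fun setT (fun k : R => powR (1 + k ^+ 2) s * cabs2 (f k)).
    by move=> mf; exact: measurable_funM.
  have wf0 (f : R -> R[i]) (k : R) : 0 <= powR (1 + k ^+ 2) s * cabs2 (f k).
    by rewrite mulr_ge0 ?cabs2_ge0.
  under eq_integral do rewrite /I0 mulr_sumr -sumEFin.
  rewrite ge0_integral_sum//=; first last.
  - by move=> i k _; rewrite lee_fin mulr_ge0// addr_ge0 ?cabs2_ge0.
  - by move=> i; apply: measurable_fun_EFin; exact: (measurable_funM mw (measurable_funD (m0 i) (m1 i))).
  rewrite ge0_sume_distrr; last first.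
    by move=> i _; apply: integral_ge0 => k _; rewrite lee_fin mulr_ge0// addr_ge0 ?cabs2_ge0.
  apply: eq_bigr => i _; under [in RHS]eq_integral do rewrite mulrDr EFinD.
  rewrite ge0_integralD//=.
  - by rewrite ge0_muleDr//; apply: integral_ge0 => k _; rewrite lee_fin.
  - by move=> k _; rewrite lee_fin.
  - by apply: measurable_fun_EFin; exact: (mwf _ (m0 i)).
  - by move=> k _; rewrite lee_fin.
  - by apply: measurable_fun_EFin; exact: (mwf _ (m1 i)).
rewrite Rr muleA -EFinM (_ : c * K * (2 * pi) / (2 * pi) = c * K); last first.
  by rewrite mulfK// gt_eqF// mulr_gt0.
rewrite [(c * K)%:E]EFinM -muleA; apply: lee_wpmul2l; first by rewrite lee_fin.
have mwI : measurable_fun setT (fun k : R => powR (1 + k ^+ 2) s * I0 k) by exact: measurable_funM.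
rewrite -ge0_integralZl//=; first last.
- by move=> k _; rewrite lee_fin mulr_ge0.
- exact: measurable_fun_EFin.
apply: ae_ge0_le_integral => //.
- by move=> k _; rewrite lee_fin.
- exact: measurable_fun_EFin.
- by move=> k _; rewrite -EFinM lee_fin mulr_ge0// mulr_ge0.
- by apply: measurable_funeM; exact: measurable_fun_EFin.
(* The solution formula prescribes nothing at k = 0, but {0} is a null set. *)
exists [set 0]; split => //; first exact: lebesgue_measure_set1.
move=> k /= nk; apply: contrapT => k0; apply: nk => _.
by rewrite -EFinM lee_fin mulrA key//; apply/eqP.
Qed.
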